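(* $53 \leq mnl(K_{3,1,1,1,1,1}) \leq 82$.
   Context: $K_{n_1,\dots,n_k}$ denotes the complete $k$-partite graph with parts of sizes $n_1,\dots,n_k$. An embedding of a finite graph $G$ means a tame embedding of $G$ in $\mathbb{R}^3$. A link in an embedding is an unordered pair of vertex-disjoint (simple closed) cycles of $G$ whose images form a non-trivial (non-split) two-component link (no three pairwise disjoint cycles exist in the graph considered here); links are counted as pairs of cycles. $mnl(G)$ is the minimal number of links in any embedding of $G$ in $\mathbb{R}^3$. *)

(* Defs.v *)
(* MathComp and MathComp-Analysis *)
From HB Require Import structures.
From mathcomp Require Import all_boot all_order all_algebra.
From mathcomp Require Import boolp classical_sets functions reals topology.
From mathcomp Require Import normedtype.

Set Implicit Arguments.
Unset Strict Implicit.
Unset Printing Implicit Defensive.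

Import Order.TTheory GRing.Theory Num.Theory.
Import numFieldNormedType.Exports.

Local Open Scope classical_set_scope.
Local Open Scope ring_scope.

Record sgraph := SGraph {
  vertex :> finType ;
  adj : rel vertex ;
  adj_sym : symmetric adj ;
  adj_irrefl : irreflexive adj }.

(* The i-th part consists of the pairs with first component i, where the size
   of that part is the i-th entry of ns. *)
Definition multipartite_vertex (ns : seq nat) : finType :=
  {i : 'I_(size ns) & 'I_(nth 0%N ns i)}.

Definition multipartite_adj (ns : seq nat) : rel (multipartite_vertex ns) :=
  fun u v => tag u != tag v.

Lemma multipartite_adj_sym ns : symmetric (@multipartite_adj ns).
Proof. by move=> u v; rewrite /multipartite_adj eq_sym. Qed.

Lemma multipartite_adj_irrefl ns : irreflexive (@multipartite_adj ns).
Proof. by move=> u; rewrite /multipartite_adj eqxx. Qed.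

Definition complete_multipartite (ns : seq nat) : sgraph :=
  SGraph (@multipartite_adj_sym ns) (@multipartite_adj_irrefl ns).

(* A cycle is represented by its set of edges, an edge being the set of its two
   endpoints, so that neither base point nor orientation is recorded; its
   vertex set is finset.cover C. *)
Definition is_cycle (G : sgraph) (C : {set {set G}}) : Prop :=
  exists s : seq G,
    [/\ (2 < size s)%N, ucycle (@adj G) s &
        C = ([set [set x; next s x] | x in s])%SET].

Definition segment (R : realType) (V : lmodType R) (a b : V) : set V :=
  [set x | exists2 t : R, 0 <= t <= 1 & x = (1 - t) *: a + t *: b].

Definition space3 (R : realType) := 'rV[R]_3.

Definition homeomorphism (S T : topologicalType) (h : S -> T) : Prop :=
  exists g : T -> S, [/\ continuous h, continuous g, cancel h g & cancel g h].

(* The geometric realization of G is taken inside R^V(G), the vertices being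
   sent to the standard basis vectors and the edges to the segments joining
   them; these segments meet only in common endpoints. *)
Definition vertex_point (R : realType) (G : sgraph) (v : G) : 'rV[R]_#|G| :=
  delta_mx 0 (enum_rank v).

Definition graph_realization (R : realType) (G : sgraph) : set 'rV[R]_#|G| :=
  [set p | (exists v : G, p = vertex_point R v) \/
           (exists u v : G, adj u v /\
              segment (vertex_point R u) (vertex_point R v) p)].

Arguments graph_realization R G : clear implicits.

Definition cycle_realization (R : realType) (G : sgraph) (C : {set {set G}}) :
    set 'rV[R]_#|G| :=
  [set p | exists u v : G, ([set u; v] \in C)%SET /\
              segment (vertex_point R u) (vertex_point R v) p].

Arguments cycle_realization R {G} C.

Definition polygonal (R : realType) (P : set (space3 R)) : Prop :=
  exists s : seq (space3 R * space3 R),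
    P = [set x | exists2 ab, ab \in s & segment ab.1 ab.2 x].

(* The realization is compact, so a continuous injection on it is a
   homeomorphism onto its image.  Only the restriction of f to the realization
   matters.  Tame: some self-homeomorphism of space makes the image polygonal. *)
Definition tame_embedding (R : realType) (G : sgraph)
    (f : 'rV[R]_#|G| -> space3 R) : Prop :=
  [/\ {within graph_realization R G, continuous f},
      {in graph_realization R G &, injective f} &
      exists2 h : space3 R -> space3 R, homeomorphism h &
        polygonal (h @` (f @` graph_realization R G))].

Definition unit_sphere (R : realType) : set (space3 R) :=
  [set x | \sum_(i < 3) x ord0 i ^+ 2 = 1].

Arguments unit_sphere R : clear implicits.

Definition tame_sphere (R : realType) (S : set (space3 R)) : Prop :=
  exists2 h : space3 R -> space3 R, homeomorphism h & S = h @` unit_sphere R.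

Definition split_link (R : realType) (A B : set (space3 R)) : Prop :=
  exists S : set (space3 R),
    [/\ tame_sphere S, A `|` B `<=` ~` S &
        forall x y, A x -> B y -> ~ connected_component (~` S) x y].

(* A link is the unordered pair L = {C1, C2} of its component cycles. *)
Definition is_link (R : realType) (G : sgraph) (f : 'rV[R]_#|G| -> space3 R)
    (L : {set {set {set G}}}) : Prop :=
  exists C1 C2 : {set {set G}},
    [/\ L = ([set C1; C2])%SET,
        is_cycle C1 /\ is_cycle C2,
        (finset.cover C1 :&: finset.cover C2)%SET = finset.set0 &
        ~ split_link (f @` cycle_realization R C1)
                     (f @` cycle_realization R C2)].

Definition nlinks (R : realType) (G : sgraph) (f : 'rV[R]_#|G| -> space3 R) :
    nat :=
  #|([set L : {set {set {set G}}} | `[< is_link f L >]])%SET|.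

(* xget returns the (unique) minimum, which exists as soon as G has a tame
   embedding in space; it would return the default value 0 otherwise, in
   particular a positive lower bound on mnl includes that existence. *)
Definition mnl (R : realType) (G : sgraph) : nat :=
  xget 0%N [set n : nat |
    (exists2 f : 'rV[R]_#|G| -> space3 R, tame_embedding f & nlinks f = n) /\
    (forall f : 'rV[R]_#|G| -> space3 R, tame_embedding f -> (n <= nlinks f)%N)].

(* Main.v *)
Require Import Defs.
From Stdlib Require Import Btauto ZArith.
From mathcomp Require Import all_boot all_order all_algebra.
From mathcomp Require Import boolp classical_sets reals topology normedtype.
From mathcomp Require Import zify ssrZ ring lra.

(** The linking numbers modulo 2 of the pairs of disjoint cycles of a spatial graph are constrained
by sums that do not depend on the embedding; counting with these gives the lower bound.  One
straight-line embedding gives the upper bound.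

Lower bound.  An arbitrary embedding is replaced by samples of its edge curves, consecutive
samples being joined by a path parallel to the x axis, then the y axis, then the z axis.  Whether
one such path passes over another, in the projection along z, is a polynomial over F_2 in the bits
that compare coordinates; ties are broken by labels, so that no general position is needed.  For
two disjoint cycles, the parity of the number of crossings at which the first passes over the
second stands for their linking number.  Two polynomial identities carry everything:
 - [passes_over_triangle] describes how a triangle of paths passes over a path, and yields
   invariance under a homotopy that avoids the other curve ([over_chain_grid]).  If a sphere
   separates two curves, then the one in the ball shrinks to a point without meeting the other
   ([split_link_shrink]), and the parity is even ([split_over_parity]).
 - [passes_over_sym] compares passing over with passing under.  After corrections that cancel along
   every cycle, over(e, e') + over(e', e) depends only on the cyclic order of the endpoints of two
   disjoint edges ([corrected_over_skew]): it is 1 exactly if e and e' cross as chords of a circle.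
Hence the sum of the parities over a family of pairs of cycles is a constant as soon as, for all
e and e', the terms over(e, e') and over(e', e) together occur an even number of times.  As in the
theorem of Conway, Gordon and Sachs for K_6 and its extension by Sachs to the Petersen family, the sum is 1
for certain families, and each of these contains a pair that is not split.  If N families have this
property and no pair of cycles lies in more than m of them, then at least N/m pairs are not split.
Seven blocks of families ([blocks]) that share no pair give 3 + 5 + 10 + 4 + 4 + 4 + 23 = 53
([parity_bound]).

Upper bound.  If the cone over a curve A from a point misses a curve B, then A and B are separated
by a sphere that is star-shaped about that point ([cone_split]).  In the straight-line embedding
given by [placement], all but at most 82 pairs of disjoint cycles satisfy this with a vertex of one
of the two cycles as the apex; this is read off from signs of 3 by 3 determinants
([misses_disjoint], [unlinked_count]). *)

Set Implicit Arguments.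
Unset Strict Implicit.
Unset Printing Implicit Defensive.

(** * Sums modulo two *)

Notation "\xor_ ( i <- r ) F" := (\big[addb/false]_(i <- r) F%B)
  (at level 41, F at level 41, i, r at level 50) : bool_scope.
Notation "\xor_ ( i < n ) F" := (\big[addb/false]_(i < n) F%B)
  (at level 41, F at level 41, i, n at level 50) : bool_scope.

Lemma addb_xorb a b : a (+) b = xorb a b. Proof. by case: a. Qed.

Ltac solve_parity := rewrite ?addb_xorb; btauto.

(** Addition modulo 2 of one element to a duplicate-free list, read as a set. *)
Definition toggle (T : eqType) (x : T) (s : seq T) :=
  if x \in s then rem x s else x :: s.

Lemma big_xor_toggle (T : eqType) (x : T) s (F : T -> bool) :
  \xor_(t <- toggle x s) F t = F x (+) \xor_(t <- s) F t.
Proof.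
rewrite /toggle; case: ifP => [xs|_]; last by rewrite big_cons.
by rewrite (perm_big _ (perm_to_rem xs)) /= big_cons addKb.
Qed.

(** * Cycles as lists of edges on the vertices 0, ..., 7 *)

(** The vertices 0, 1, 2 form the part of size three and 3, ..., 7 the singleton parts.  Numbers
rather than vertices of the graph let the finite checks below run by computation. *)
Definition edge := (nat * nat)%type.
Definition edge_of (i j : nat) : edge := if i < j then (i, j) else (j, i).

Definition adjacent (i j : nat) : bool := (i != j) && ((2 < i) || (2 < j)).

(** Simple paths, listed by extension at the head, of the given number of vertices. *)
Fixpoint walks (n : nat) : seq (seq nat) :=
  if n is n'.+1 then
    [seq x :: w | w <- walks n', x <- [seq x <- iota 0 8 | (x \notin w) &&
        (if w is y :: _ then adjacent x y else true)]]
  else [:: [::]].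

(** Two disjoint cycles have at most eight vertices in all, hence at most five each. *)
Definition cycle_walks : seq (seq nat) :=
  [seq s <- walks 3 ++ walks 4 ++ walks 5 | adjacent (last 0 s) (head 0 s)].

Definition cycle_edges (s : seq nat) : seq edge :=
  [seq edge_of e.1 e.2 | e <- zip s (rot 1 s)].

Definition edges : seq edge :=
  [seq e <- [seq (i, j) | i <- iota 0 8, j <- iota 0 8] |
   (e.1 < e.2) && adjacent e.1 e.2].

(** A normal form that decides equality of cycles as sets of edges. *)
Definition indicator (es : seq edge) : bitseq := [seq e \in es | e <- edges].

(** Each cycle arises from several closed walks; the kept one starts at the least vertex and is
oriented so that its second vertex is less than its last. *)
Definition cycles : seq (seq edge) :=
  [seq cycle_edges s | s <- cycle_walks &
     all (leq (head 0 s)) s && (nth 0 s 1 < last 0 s)].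

Definition meet (e e' : edge) : bool :=
  [|| e.1 == e'.1, e.1 == e'.2, e.2 == e'.1 | e.2 == e'.2].

Definition disjointb (c d : seq edge) : bool := ~~ has (fun e => has (meet e) d) c.

Fixpoint unordered_pairs (l : seq (seq edge)) : seq (seq edge * seq edge) :=
  if l is c :: l' then
    [seq (c, d) | d <- l' & disjointb c d] ++ unordered_pairs l'
  else [::].

Definition cycle_pairs := unordered_pairs cycles.

(** * The counting argument *)

(** Any total order would do: it only selects one of the two terms form(e, e'), form(e', e). *)
Definition edge_lt (e e' : edge) : bool :=
  (e.1 < e'.1) || ((e.1 == e'.1) && (e.2 < e'.2)).

(** For disjoint edges, whether the chords e and e' of a circle cross when the vertices
0, ..., 7 lie on the circle in this order. *)
Definition interleave (e e' : edge) : bool :=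
  ((e.1 < e'.1) (+) (e.1 < e'.2)) (+) ((e.2 < e'.1) (+) (e.2 < e'.2)).

(** One step of rewriting a formal sum of terms form(e, e') modulo the relation
form(e, e') + form(e', e) = interleave(e, e'): the accumulator is a constant together with the set of
terms, with e before e', that are left. *)
Definition add_term (t : edge * edge) (acc : bool * seq (edge * edge)) :=
  if edge_lt t.1 t.2 then (acc.1, toggle t acc.2)
  else (interleave t.1 t.2 (+) acc.1, toggle (t.2, t.1) acc.2).

Definition pair_terms (p : seq edge * seq edge) : seq (edge * edge) :=
  [seq (e, e') | e <- p.1, e' <- p.2].

Definition reduce_terms (ts : seq (edge * edge)) :=
  foldr add_term (false, [::]) ts.

(** The formal sum of the parities of ps reduces to the constant 1. *)
Definition odd_total (ps : seq (seq edge * seq edge)) : bool :=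
  reduce_terms (flatten [seq pair_terms p | p <- ps]) == (true, [::]).

(** One member of a family stands for the set of pairs of disjoint cycles of given total length in
the subgraph obtained by removing the edges that satisfy a predicate. *)
Definition family := seq (nat * (edge -> bool)).

Definition incident (x : nat) : (edge -> bool) := fun e => (e.1 == x) || (e.2 == x).
Definition inside (A : seq nat) : (edge -> bool) := fun e => (e.1 \in A) && (e.2 \in A).
Definition between (x : nat) (A : seq nat) : (edge -> bool) :=
  fun e => ((e.1 == x) && (e.2 \in A)) || ((e.2 == x) && (e.1 \in A)).

Definition big_part := [:: 0; 1; 2].
Definition singles := [:: 3; 4; 5; 6; 7].

(** Removing all edges at a vertex amounts to deleting the vertex, since every vertex of a cycle
lies on one of its edges. *)
Definition selects (h : nat * (edge -> bool)) (p : seq edge * seq edge) : bool :=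
  (size p.1 + size p.2 == h.1) && ~~ (has h.2 p.1 || has h.2 p.2).

(** Two vertices of the part of size three are deleted, which leaves a complete graph K_6; its
disjoint cycles are the ten pairs of triangles. *)
Definition K6_with (a : nat) : nat * (edge -> bool) :=
  let A := rem a big_part in (6, fun e => has (incident^~ e) A).

(** K_{3,3,1} on the seven vertices other than the dropped one, with parts A, B and the remaining
vertex. *)
Definition K331 (dropped : nat) (A B : seq nat) : nat * (edge -> bool) :=
  (7, fun e => [|| incident dropped e, inside A e | inside B e]).

(** The graph with eight vertices in the Petersen family other than K_{4,4} minus an edge: the
remaining vertex w of the big part is joined to y and to B and B', which span a 4-cycle, y is joined
to a and a', and these to B and to B' respectively. *)
Definition P8 (y : nat) (a a' : nat) (B B' : seq nat) : nat * (edge -> bool) :=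
  (8, fun e => [|| between y (B ++ B') e, inside B e, inside B' e, between a B' e
                 | between a' B e]).

Definition K6_family : family := [seq K6_with a | a <- big_part].

(** The graph with parts 3, 1, 1, 1, 1 has 18 pairs of disjoint triangles.  No such pair lies in a
K_6 of the previous family, since both triangles use a vertex of the big part. *)
Definition triangle_family : family := [seq (6, incident b) | b <- singles].

(** The big part is one of the parts of size three, so x is dropped and z is the vertex of
degree six. *)
Definition K331_family : family :=
  [seq K331 x big_part (rem z (rem x singles)) | x <- singles, z <- rem x singles].

(** Here two vertices of the big part are joined by a singleton x to form a part of size three. *)
Definition K331_family_without (a : nat) : family :=
  [seq K331 a (x :: rem a big_part) (rem z (rem x singles))
  | x <- singles, z <- rem x singles].

Definition ordered_pairs (A : seq nat) : seq (nat * nat) :=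
  [seq uv <- [seq (u, v) | u <- A, v <- A] | uv.1 < uv.2].

Definition P8_family_at (a : nat) : family :=
  let A := rem a big_part in
  [seq P8 y (nth 0 A 0) (nth 0 A 1) [:: uv.1; uv.2]
         (rem uv.2 (rem uv.1 (rem y singles)))
  | y <- singles, uv <- ordered_pairs (rem y singles)].

Definition P8_family : family := flatten [seq P8_family_at a | a <- big_part].

(** A family comes with the largest number of its members that can contain a given pair.  The blocks
have 3, 5, 20, 20, 20, 20 and 90 members. *)
Definition blocks : seq (nat * family) :=
  [:: (1, K6_family); (1, triangle_family); (2, K331_family);
      (6, K331_family_without 0); (6, K331_family_without 1);
      (6, K331_family_without 2); (4, P8_family)].

Definition ceil_div n m := (n + m.-1) %/ m.

(** No block contains the pair too often, and at most one block contains it at all, so that the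
bounds obtained from the blocks add up. *)
Definition pair_check (bs : seq (nat * family)) (p : seq edge * seq edge) : bool :=
  let ns := [seq (b.1, count (selects^~ p) b.2) | b <- bs] in
  all (fun n => n.2 <= n.1) ns && (count (fun n => 0 < n.2) ns <= 1).

Lemma blocks_odd : all (fun b => (0 < b.1) && all (fun h => odd_total
  [seq p <- cycle_pairs | selects h p]) b.2) blocks.
Proof. by vm_cast_no_check (erefl true). Qed.

Lemma blocks_cover : all (pair_check blocks) cycle_pairs.
Proof. by vm_cast_no_check (erefl true). Qed.

Section LinkingBound.
Variable form : edge -> edge -> bool.

Definition parity (p : seq edge * seq edge) : bool :=
  \xor_(e <- p.1) \xor_(e' <- p.2) form e e'.

Definition skew (p : seq edge * seq edge) : Prop :=
  forall e e', e \in p.1 -> e' \in p.2 -> form e e' (+) form e' e = interleave e e'.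

Lemma parity_terms p : parity p = \xor_(t <- pair_terms p) form t.1 t.2.
Proof. by rewrite /parity /pair_terms big_allpairs. Qed.

Lemma reduce_terms_sound ts :
    (forall t, t \in ts -> form t.1 t.2 (+) form t.2 t.1 = interleave t.1 t.2) ->
  \xor_(t <- ts) form t.1 t.2 =
  (reduce_terms ts).1 (+) \xor_(t <- (reduce_terms ts).2) form t.1 t.2.
Proof.
elim: ts => [|t ts IHts] sk; first by rewrite !big_nil.
rewrite big_cons {}IHts; last by move=> u uts; apply: sk; rewrite inE uts orbT.
have := sk t (mem_head _ _).
rewrite /reduce_terms /= -/(reduce_terms ts) /add_term.
case: ifP => _ /= skt; rewrite big_xor_toggle /=; first by rewrite addbCA.
rewrite -skt; case: (form t.1 t.2); case: (form t.2 t.1);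
by case: (reduce_terms ts).1 => /=; rewrite ?negbK.
Qed.

Lemma odd_total_sound ps : odd_total ps -> (forall p, p \in ps -> skew p) ->
  \xor_(p <- ps) parity p = true.
Proof.
move=> /eqP odd_ps sk.
under eq_bigr do rewrite parity_terms.
have -> : \xor_(p <- ps) (\xor_(t <- pair_terms p) form t.1 t.2)
    = \xor_(t <- flatten [seq pair_terms p | p <- ps]) form t.1 t.2.
  by rewrite big_flatten big_map.
have {}sk t : t \in flatten [seq pair_terms p | p <- ps] ->
    form t.1 t.2 (+) form t.2 t.1 = interleave t.1 t.2.
  move=> /flatten_mapP [p /sk skp /allpairsP [[e e'] /= [ep e'p ->]]] /=.
  exact: skp.
by rewrite (reduce_terms_sound sk) odd_ps big_nil.
Qed.

Lemma leq_sum_all (T : Type) (a : pred T) (r : seq T) (f g : T -> nat) :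
  all a r -> (forall x, a x -> f x <= g x) -> \sum_(x <- r) f x <= \sum_(x <- r) g x.
Proof.
move=> + fg; elim: r => [|x r IHr] /=; first by rewrite !big_nil.
by move=> /andP[ax /IHr ?]; rewrite !big_cons leq_add ?fg.
Qed.

Variable pairs : seq (seq edge * seq edge).
Hypothesis skew_pairs : forall p, p \in pairs -> skew p.

(** Double counting: each member contains an odd pair, and each pair lies in at most m members. *)
Lemma family_bound (m : nat) (F : family) :
    all (fun h => odd_total [seq p <- pairs | selects h p]) F ->
    (forall p, p \in pairs -> count (selects^~ p) F <= m) -> 0 < m ->
  ceil_div (size F) m <=
    count (fun p => parity p && has (selects^~ p) F) pairs.
Proof.
move=> oddF coverF m_gt0.
suff : size F <= m * count (fun p => parity p && has (selects^~ p) F) pairs.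
  rewrite /ceil_div; set k := count _ _ => Fk.
  rewrite -ltnS ltn_divLR // mulSn mulnC addnC.
  by rewrite -[X in _ < X + _](prednK m_gt0) addSn ltnS leq_add2l.
rewrite -!sum1_count big_distrr /= -sum1_size.
apply: (@leq_trans (\sum_(h <- F) \sum_(p <- pairs | selects h p) parity p)).
  apply: (leq_sum_all oddF) => h oddh.
  have /= := odd_total_sound oddh.
  rewrite big_filter => xorh.
  have {}xorh : \big[addb/false]_(p <- pairs | selects h p) parity p = true.
    by apply: xorh => p; rewrite mem_filter => /andP[_ /skew_pairs].
  (* If no selected pair were odd, then the sum of the parities would be 0. *)
  rewrite lt0n; apply: contraPneq xorh => /eqP.
  rewrite sum_nat_seq_eq0 => /allP par0.
  rewrite big_seq_cond big1 // => p /andP[pP sp].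
  by have := par0 p pP; rewrite sp eqb0 => /negbTE.
under eq_bigr do rewrite big_mkcond.
rewrite exchange_big /= [X in _ <= X]big_mkcond /=.
rewrite big_seq [X in _ <= X]big_seq; apply: leq_sum => p pP.
case: (parity p) => /=; last by rewrite big1 // => h _; case: ifP.
rewrite -big_mkcond sum1_count; case: ifPn => [_|]; first by rewrite muln1 coverF.
by rewrite has_count lt0n negbK => /eqP ->.
Qed.

Lemma blocks_bound (bs : seq (nat * family)) :
    all (fun b => (0 < b.1) && all (fun h => odd_total
      [seq p <- pairs | selects h p]) b.2) bs ->
    all (pair_check bs) pairs ->
  sumn [seq ceil_div (size b.2) b.1 | b <- bs] <= count parity pairs.
Proof.
move=> odd_bs /allP cover.
rewrite sumnE big_map.
apply: (@leq_trans (\sum_(b <- bs)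
    count (fun p => parity p && has (selects^~ p) b.2) pairs)).
  have : all (fun b => [&& 0 < b.1, all (fun h => odd_total
      [seq p <- pairs | selects h p]) b.2 & all (fun p =>
      count (selects^~ p) b.2 <= b.1) pairs]) bs.
    elim: bs odd_bs cover => //= b bs IHbs /andP[/andP[-> ->] odd_bs] cover /=.
    apply/andP; split.
      by apply/allP => p /cover /andP[/andP[]].
    apply: IHbs odd_bs _ => p /cover; rewrite /pair_check /=.
    by move=> /andP[/andP[_ ->]] /(leq_trans (leq_addl _ _)).
  move=> /leq_sum_all; apply=> b /and3P[b_gt0 oddb /allP coverb].
  exact: family_bound.
under eq_bigr do rewrite -sum1_count big_mkcond.
rewrite exchange_big /= -sum1_count [X in _ <= X]big_mkcond /=.
rewrite big_seq [X in _ <= X]big_seq; apply: leq_sum => p /cover /andP[_].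
rewrite count_map => disj.
case: (parity p) => /=; last by rewrite big1.
rewrite -big_mkcond sum1_count; apply: leq_trans disj.
rewrite (eq_count (a2 := preim (fun b => (b.1, count (selects^~ p) b.2))
  (fun n => 0 < n.2))) // => b /=.
by rewrite has_count.
Qed.

End LinkingBound.

Lemma parity_bound (form : edge -> edge -> bool) :
  (forall p, p \in cycle_pairs -> skew form p) ->
  53 <= count (parity form) cycle_pairs.
Proof.
move=> sk; have -> : 53 = sumn [seq ceil_div (size b.2) b.1 | b <- blocks].
  by vm_compute.
exact: (blocks_bound sk blocks_odd blocks_cover).
Qed.

(** * The cycles of the graph *)

Local Notation G := (complete_multipartite [:: 3; 1; 1; 1; 1; 1]%N).

Definition part_vertex (i : 'I_6) (j : 'I_(nth 0 [:: 3; 1; 1; 1; 1; 1] i)) : G :=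
  existT _ i j.

Definition vtx (k : nat) : G :=
  match k with
  | 0 => @part_vertex (@Ordinal 6 0 isT) (@Ordinal 3 0 isT)
  | 1 => @part_vertex (@Ordinal 6 0 isT) (@Ordinal 3 1 isT)
  | 2 => @part_vertex (@Ordinal 6 0 isT) (@Ordinal 3 2 isT)
  | 3 => @part_vertex (@Ordinal 6 1 isT) (@Ordinal 1 0 isT)
  | 4 => @part_vertex (@Ordinal 6 2 isT) (@Ordinal 1 0 isT)
  | 5 => @part_vertex (@Ordinal 6 3 isT) (@Ordinal 1 0 isT)
  | 6 => @part_vertex (@Ordinal 6 4 isT) (@Ordinal 1 0 isT)
  | _ => @part_vertex (@Ordinal 6 5 isT) (@Ordinal 1 0 isT)
  end.

(** The parts come in the order 3, 1, 1, 1, 1, 1, so part 0 gives 0, 1, 2 and part i > 0 gives i + 2. *)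
Definition code (v : G) : nat :=
  if tag v == 0 :> nat then nat_of_ord (tagged v) else (tag v).+2.

Lemma vtxK k : k < 8 -> code (vtx k) = k.
Proof. by do 8![case: k => [|k] //]. Qed.

Lemma codeK : cancel code vtx.
Proof.
case=> -[[|[|[|[|[|[|i]]]]]] // lt_i] [j lt_j]; rewrite /code /= /part_vertex;
  case: j lt_j => [|[|[|j]]] // lt_j;
  by rewrite (bool_irrelevance lt_i isT) (bool_irrelevance lt_j isT).
Qed.

Lemma code_lt v : code v < 8.
Proof.
case: v => -[[|[|[|[|[|[|i]]]]]] // lt_i] [j lt_j]; rewrite /code //=.
by apply: leq_trans lt_j _.
Qed.

Lemma code_inj : injective code. Proof. exact: can_inj codeK. Qed.

Lemma vtx_inj k l : k < 8 -> l < 8 -> vtx k = vtx l -> k = l.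
Proof. by move=> k8 l8 /(congr1 code); rewrite !vtxK. Qed.

Lemma adj_vtx k l : k < 8 -> l < 8 -> adj (vtx k) (vtx l) = adjacent k l.
Proof.
have /allP all_kl : all (fun k => all (fun l =>
    adj (vtx k) (vtx l) == adjacent k l) (iota 0 8)) (iota 0 8) by [].
move=> k8 l8; have kI : k \in iota 0 8 by rewrite mem_iota.
have lI : l \in iota 0 8 by rewrite mem_iota.
exact: eqP (allP (all_kl k kI) l lI).
Qed.

Lemma adj_code u v : adj u v = adjacent (code u) (code v).
Proof. by rewrite -adj_vtx ?code_lt // !codeK. Qed.

Definition vertex_set (e : edge) : {set G} := [set vtx e.1; vtx e.2].

Definition realize (c : seq edge) : {set {set G}} :=
  [set:: [seq vertex_set e | e <- c]].

Lemma vertex_set_edge_of i j : vertex_set (edge_of i j) = [set vtx i; vtx j].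
Proof. by rewrite /vertex_set /edge_of; case: ifP => //= _; rewrite finset.setUC. Qed.

Lemma zip_rot_next (T : eqType) (s : seq T) : uniq s ->
  zip s (rot 1 s) = [seq (x, next s x) | x <- s].
Proof.
case: s => [|x s] // us; rewrite rot1_cons.
apply: (@eq_from_nth _ (x, x)).
  by rewrite size_map size_zip size_rcons minnn.
move=> i; rewrite size_zip size_rcons minnn => lti.
rewrite nth_zip ?size_rcons // (nth_map x) //.
rewrite next_nth mem_nth // index_uniq //.
rewrite nth_rcons; case: ltnP => // le_si.
by rewrite (nth_default x le_si) if_same.
Qed.

Lemma realize_walk (s : seq nat) : all (gtn 8) s -> uniq s ->
  realize (cycle_edges s) = [set [set x; next (map vtx s) x] | x in map vtx s].
Proof.
move=> /allP s8 us.
have uvs : uniq (map vtx s).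
  rewrite map_inj_in_uniq // => x y xs ys.
  by apply: vtx_inj; [exact: s8 xs | exact: s8 ys].
have next_vtx x : x \in s -> next (map vtx s) (vtx x) = vtx (next s x).
  move=> xs; have sE : map code (map vtx s) = s.
    by rewrite -map_comp map_id_in // => y /s8 /vtxK.
  have := next_map code_inj uvs (vtx x).
  by rewrite sE vtxK ?(s8 x xs : x < 8) // => ->; rewrite codeK.
apply/setP => E; rewrite /realize !inE; apply/mapP/imsetP.
  case=> e /mapP[p]; rewrite zip_rot_next // => /mapP[x xs ->] /= -> ->.
  by exists (vtx x); rewrite ?map_f // vertex_set_edge_of next_vtx.
case=> _ /mapP[x xs ->] ->; exists (edge_of x (next s x)); last first.
  by rewrite vertex_set_edge_of next_vtx.
apply/mapP; exists (x, next s x) => //.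
by rewrite zip_rot_next //; apply: map_f.
Qed.

Lemma edgeP e : e \in edges ->
  [/\ e.1 < e.2, e.1 < 8, e.2 < 8 & adjacent e.1 e.2].
Proof.
have all_e : all (fun e => [&& e.1 < e.2, e.1 < 8, e.2 < 8 & adjacent e.1 e.2])
    edges by [].
by move=> /(allP all_e) /and4P[].
Qed.

Lemma vertex_set_inj e e' : e \in edges -> e' \in edges ->
  vertex_set e = vertex_set e' -> e = e'.
Proof.
case: e e' => [i j] [k l] /edgeP /= [ij i8 j8 _] /edgeP /= [kl k8 l8 _] E.
have mem m : m < 8 -> (vtx m \in vertex_set (i, j)) = ((m == i) || (m == j)).
  by move=> m8; rewrite !inE -!(inj_eq code_inj) !vtxK.
have : (k == i) || (k == j) by rewrite -mem // E !inE eqxx.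
have : (l == i) || (l == j) by rewrite -mem // E !inE eqxx orbT.
by move=> /orP[/eqP le|/eqP le] /orP[/eqP ke|/eqP ke]; congr (_, _); lia.
Qed.

Lemma mem_realize c e : {subset c <= edges} -> e \in edges ->
  (vertex_set e \in realize c) = (e \in c).
Proof.
move=> cE eE; rewrite inE; apply/mapP/idP => [[e' e'c ee']|ec]; last by exists e.
by rewrite (vertex_set_inj eE (cE _ e'c) ee').
Qed.

Lemma realizeP c E : reflect (exists2 e, e \in c & E = vertex_set e) (E \in realize c).
Proof. by rewrite inE; apply: mapP. Qed.

Lemma realize_indicator c d : {subset c <= edges} -> {subset d <= edges} ->
  (realize c == realize d) = (indicator c == indicator d).
Proof.
move=> cE dE; apply/eqP/eqP => [E|/eq_in_map E].
  by apply/eq_in_map => e eE; rewrite -(mem_realize cE eE) -(mem_realize dE eE) E.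
apply/setP => X; apply/realizeP/realizeP => -[e ec ->]; exists e => //.
  by rewrite -E // cE.
by rewrite E // dE.
Qed.

Lemma disjoint_realize c d : {subset c <= edges} -> {subset d <= edges} ->
  (finset.cover (realize c) :&: finset.cover (realize d) == finset.set0) = disjointb c d.
Proof.
move=> cE dE; apply/eqP/hasPn => [E e ec|E].
  apply/hasPn => e' e'd; have [_ i8 j8 _] := edgeP (cE e ec).
  have [_ k8 l8 _] := edgeP (dE e' e'd).
  have off x y : x \in [:: e.1; e.2] -> y \in [:: e'.1; e'.2] -> x != y.
    move=> xe ye'; apply/eqP => xy.
    have /setP/(_ (vtx x)) := E; rewrite !inE => /negP; apply; apply/andP; split.
      apply/finset.bigcupP; exists (vertex_set e); first by apply/realizeP; exists e.
      by move: xe; rewrite !inE => /orP[]/eqP->; rewrite eqxx ?orbT.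
    apply/finset.bigcupP; exists (vertex_set e'); first by apply/realizeP; exists e'.
    by move: ye'; rewrite xy !inE => /orP[]/eqP->; rewrite eqxx ?orbT.
  by rewrite /meet !negb_or !off ?inE ?eqxx ?orbT.
apply/setP => v; rewrite !inE; apply/negP => /andP[].
move=> /finset.bigcupP[_ /realizeP[e ec ->] ve] /finset.bigcupP[_ /realizeP[e' e'd ->] ve'].
have [_ i8 j8 _] := edgeP (cE e ec); have [_ k8 l8 _] := edgeP (dE e' e'd).
have /hasPn/(_ e' e'd) := E e ec; rewrite /meet !negb_or => /and4P[].
move: ve ve'; rewrite !inE -!(inj_eq code_inj) !vtxK //.
by move=> /orP[]/eqP-> /orP[]/eqP->; rewrite eqxx.
Qed.

(** The second condition says that every vertex lies on an even number of edges of c. *)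
Definition cycle_wf (c : seq edge) : bool :=
  all (mem edges) c &&
  (foldr (fun e acc => toggle e.1 (toggle e.2 acc)) [::] c == [::]).

Lemma cycles_wf : all cycle_wf cycles.
Proof. by vm_cast_no_check (erefl true). Qed.

Lemma cycle_walks_wf : all (fun s => [&& 2 < size s, uniq s, cycle adjacent s
   & all (gtn 8) s]) cycle_walks.
Proof. by vm_cast_no_check (erefl true). Qed.

Lemma cycles_indicator : uniq (map indicator cycles).
Proof. by vm_cast_no_check (erefl true). Qed.

Lemma cycle_walks_indicator :
  let inds := map indicator cycles in
  all (fun s => indicator (cycle_edges s) \in inds) cycle_walks.
Proof. by vm_cast_no_check (erefl true). Qed.

Lemma cycle_walks_edges : all (fun s => all (mem edges) (cycle_edges s)) cycle_walks.
Proof. by vm_cast_no_check (erefl true). Qed.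

Lemma cycles_edges c : c \in cycles -> {subset c <= edges}.
Proof. by move=> /(allP cycles_wf) /andP[/allP cE _]. Qed.

Lemma uniq_map_inj (T U : eqType) (f : T -> U) (s : seq T) :
  uniq (map f s) -> {in s &, injective f}.
Proof.
move=> u x y xs ys fxy.
have := nth_uniq (f x) (i := index x s) (j := index y s) _ _ u.
rewrite size_map !index_mem => /(_ xs ys).
rewrite !(nth_map x) ?index_mem // !nth_index // fxy eqxx => /esym/eqP E.
by rewrite -[x](nth_index x xs) E nth_index.
Qed.

Lemma realize_inj : {in cycles &, injective realize}.
Proof.
move=> c d cC dC /eqP; rewrite realize_indicator; try exact: cycles_edges.
by move=> /eqP; apply: uniq_map_inj cycles_indicator _ _ cC dC.
Qed.

Lemma realize_is_cycle c : c \in cycles -> is_cycle (realize c).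
Proof.
move=> /mapP[s]; rewrite mem_filter => /andP[_ /(allP cycle_walks_wf)].
move=> /and4P[s3 us cs s8] ->.
have uvs : uniq (map vtx s).
  by rewrite map_inj_in_uniq // => x y /(allP s8) x8 /(allP s8); apply: vtx_inj.
exists (map vtx s); split; first by rewrite size_map.
  apply/andP; split; last exact: uvs.
  rewrite (mono_cycle_in (P := gtn 8) (e := adjacent)) // => k l k8 l8.
  exact: adj_vtx.
exact: realize_walk.
Qed.

Lemma mem_walks s : uniq s -> all (gtn 8) s -> sorted adjacent s ->
  s \in walks (size s).
Proof.
elim: s => // x s IHs; rewrite [uniq _]/= [all _ _]/=.
move=> /andP[xs us] /andP[x8 s8] p.
have ss : sorted adjacent s by case: s p {IHs xs us s8} => //= y s /andP[].
apply/allpairsPdep; exists s, x; split=> //; first exact: IHs.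
rewrite mem_filter xs mem_iota add0n (x8 : x < 8) leq0n !andbT /=.
by case: s p {IHs xs us s8 ss} => //= y s /andP[].
Qed.

(** The vertices of the cycle, read as numbers, form a closed walk of length at most five, and
the finite list of these is exhausted by the cycles up to choice of the starting point and direction. *)
Lemma is_cycle_realize (C : {set {set G}}) : is_cycle C -> #|finset.cover C| <= 5 ->
  exists2 c, c \in cycles & C = realize c.
Proof.
move=> [s [s3 /andP[cs us] ->]] cov5.
have s5 : size s <= 5.
  apply: leq_trans cov5; rewrite -(card_uniqP us); apply/subset_leq_card/fintype.subsetP.
  move=> x xs; apply/finset.bigcupP; exists [set x; next s x]; last by rewrite !inE eqxx.
  exact: imset_f.
have sE : map vtx (map code s) = s by rewrite -map_comp map_id_in // => x _; apply: codeK.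
have sW : map code s \in cycle_walks.
  have c_s : cycle adjacent (map code s).
    by rewrite cycle_map -(eq_cycle adj_code).
  rewrite mem_filter; apply/andP; split.
    by case: s s3 {sE us s5 cov5 cs} c_s => //= x s _; rewrite rcons_path => /andP[].
  have : map code s \in walks (size (map code s)).
    apply: mem_walks; first by rewrite map_inj_uniq //; apply: code_inj.
      by apply/allP => _ /mapP[v _ ->]; apply: code_lt.
    by case: s s3 {sE us s5 cov5 cs} c_s => //= x s _; rewrite rcons_path => /andP[].
  rewrite size_map (mem_cat _ (walks 3)) (mem_cat _ (walks 4)).
  move: (map code s) => w; move: s3 s5; case: (size s) => [|[|[|[|[|[|n]]]]]] // _ _ sW.
  - by apply/orP; left.
  - by apply/orP; right; apply/orP; left.
  - by apply/orP; right; apply/orP; right.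
have /and4P[_ us' _ s8'] := allP cycle_walks_wf _ sW.
rewrite -{1 2}sE -realize_walk //.
have /mapP[c cC cE] := allP cycle_walks_indicator _ sW.
exists c => //; apply/eqP; rewrite realize_indicator ?cE //; last exact: cycles_edges.
exact/allP/(allP cycle_walks_edges).
Qed.

Lemma card_cover_cycle (C : {set {set G}}) : is_cycle C -> 2 < #|finset.cover C|.
Proof.
move=> [s [s3 /andP[cs us] ->]]; apply: leq_trans s3 _.
rewrite -(card_uniqP us); apply/subset_leq_card/fintype.subsetP.
move=> x xs; apply/finset.bigcupP; exists [set x; next s x]; last by rewrite !inE eqxx.
exact: imset_f.
Qed.

Lemma card_G : #|G| = 8.
Proof.
have <- : size [seq vtx k | k <- iota 0 8] = 8 by [].
have u : uniq [seq vtx k | k <- iota 0 8].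
  rewrite map_inj_in_uniq ?iota_uniq // => x y; rewrite !mem_iota.
  exact: vtx_inj.
rewrite -(card_uniqP u); apply: eq_card => v; rewrite inE; apply/esym/mapP.
by exists (code v); rewrite ?codeK // mem_iota code_lt.
Qed.

Lemma mem_unordered_pairs l p : p \in unordered_pairs l ->
  [/\ p.1 \in l, p.2 \in l & disjointb p.1 p.2].
Proof.
elim: l => [|c l IHl] //=; rewrite mem_cat => /orP[/mapP[d]|/IHl[p1 p2 ?]].
  rewrite mem_filter => /andP[cd dl] -> /=; split=> //; first exact: mem_head.
  by rewrite inE dl orbT.
by split=> //; rewrite inE ?p1 ?p2 orbT.
Qed.

Lemma unordered_pairs_uniq l : uniq l -> uniq (unordered_pairs l).
Proof.
elim: l => //= c l IHl /andP[cl ul]; rewrite cat_uniq IHl // andbT.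
rewrite map_inj_uniq ?filter_uniq //=; last by move=> d d' [].
apply/hasPn => p /mem_unordered_pairs[p1 _ _]; apply/mapP => -[d _ pE].
by move: cl; rewrite pE in p1; rewrite p1.
Qed.

Lemma unordered_pairs_asym l c d : uniq l ->
  (c, d) \in unordered_pairs l -> (d, c) \notin unordered_pairs l.
Proof.
elim: l => //= x l IHl /andP[xl ul].
rewrite !mem_cat => /orP[/mapP[y]|cd].
  rewrite mem_filter => /andP[_ yl] [-> ->]; rewrite negb_or; apply/andP; split.
    by apply/mapP => -[z]; rewrite mem_filter => /andP[_ zl] [_ xz];
      move: xl; rewrite xz zl.
  by apply: contra xl => /mem_unordered_pairs[].
rewrite negb_or IHl // andbT; apply/mapP => -[z _ [dx _]].
by have [/= _ + _] := mem_unordered_pairs cd; rewrite dx (negPf xl).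
Qed.

Lemma unordered_pairsP l c d : c \in l -> d \in l -> c != d -> disjointb c d ->
  disjointb d c -> ((c, d) \in unordered_pairs l) || ((d, c) \in unordered_pairs l).
Proof.
elim: l => //= x l IHl; rewrite !inE !mem_cat => /predU1P[->|cl] /predU1P[->|dl].
- by rewrite eqxx.
- move=> _ xd _; apply/orP; left; apply/orP; left; apply/mapP; exists d => //.
  by rewrite mem_filter xd.
- move=> _ _ xc; apply/orP; right; apply/orP; left; apply/mapP; exists c => //.
  by rewrite mem_filter xc.
- move=> cd d1 d2; have /orP[->|->] := IHl cl dl cd d1 d2; by rewrite ?orbT.
Qed.

Lemma cycles_uniq : uniq cycles.
Proof. exact: map_uniq cycles_indicator. Qed.

Lemma cycles_nonempty c : c \in cycles -> exists e, e \in c.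
Proof.
have /allP ne : all (fun c => c != [::]) cycles by vm_cast_no_check (erefl true).
by move=> /ne; case: c => // e c _; exists e; apply: mem_head.
Qed.

Definition link_of (p : seq edge * seq edge) : {set {set {set G}}} :=
  [set realize p.1; realize p.2]%SET.

Lemma link_of_inj : {in cycle_pairs &, injective link_of}.
Proof.
move=> [c d] [c' d'] cdP cdP' /setP E.
have [/= cC dC _] := mem_unordered_pairs cdP.
have [/= cC' dC' _] := mem_unordered_pairs cdP'.
have neq_pair x y : (x, y) \in cycle_pairs -> x != y.
  apply: contraL => /eqP->; apply/negP => yy.
  by have := unordered_pairs_asym cycles_uniq yy; rewrite yy.
have mem x : x \in cycles -> (x == c) || (x == d) = ((x == c') || (x == d')).
  move=> xC; have := E (realize x); rewrite !inE.
  by rewrite !(inj_in_eq realize_inj).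
have := mem _ cC; have := mem _ dC; rewrite !eqxx ?orbT.
move=> /esym/orP[/eqP dE|/eqP dE] /esym/orP[/eqP cE|/eqP cE]; rewrite ?cE ?dE //.
- by have := neq_pair _ _ cdP; rewrite cE dE eqxx.
- have := unordered_pairs_asym cycles_uniq cdP.
  by rewrite cE dE (cdP' : (c', d') \in unordered_pairs cycles).
- by have := neq_pair _ _ cdP; rewrite cE dE eqxx.
Qed.

Import Order.TTheory GRing.Theory Num.Theory.
Import numFieldNormedType.Exports.
Local Open Scope classical_set_scope.
Local Open Scope ring_scope.

(** * Crossings of axis-parallel paths *)

Section Crossing.
Variable R : realType.
(** A label makes the comparison of coordinates below a strict total order on points with
distinct labels, as a small perturbation of the points would. *)
Definition labelled_point := (nat * 'rV[R]_3)%type.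
Implicit Types p q r c d : labelled_point.

Definition before (k : 'I_3) p c :=
  (p.2 0 k < c.2 0 k) || ((p.2 0 k == c.2 0 k) && (p.1 < c.1)%N).

Lemma before_anti k p c : p.1 != c.1 -> before k c p = ~~ before k p c.
Proof.
rewrite /before neq_ltn; case: (ltgtP (p.2 0 k) (c.2 0 k)) => //= _.
by case: (ltngtP p.1 c.1).
Qed.

Definition x_axis : 'I_3 := inord 0.
Definition y_axis : 'I_3 := inord 1.
Definition z_axis : 'I_3 := inord 2.

(** From p to q the path runs along x at the y coordinate of p, then along y at the x coordinate of q,
then along z; likewise from c to d.  The two summands are the crossings, in the projection along z, of
the x part of one path with the y part of the other. *)
Definition cross (p q c d : labelled_point) : bool :=
  ((before x_axis p d (+) before x_axis q d) && (before y_axis p c (+) before y_axis p d))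
  (+) ((before y_axis p c (+) before y_axis q c) && (before x_axis q c (+) before x_axis q d)).

(** The x and y parts of a path from p lie at the height of p, so the heights at all crossings
compare as those of p and c. *)
Definition passes_over p q c d : bool := ~~ before z_axis p c && cross p q c d.

(** In the projection the paths p-q, q-r and p-r bound a rectangle, with sides from the x coordinate of
q to that of r and from the y coordinate of p to that of q.  This is the condition that c lies below it. *)
Definition shadow (p q r c : labelled_point) : bool :=
  [&& before x_axis q c (+) before x_axis r c, before y_axis p c (+) before y_axis q c
    & ~~ before z_axis p c].

(** The loop formed by the paths p-q, q-r and p-r bounds the rectangle of [shadow] at the height of p
together with two vertical walls between the path q-r and this height.  The summands count the
crossings of the path c-d with the rectangle and with the walls. *)
Definition pierce (p q r c d : labelled_point) : bool :=
  [&& before x_axis q d (+) before x_axis r d, before y_axis p d (+) before y_axis q d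
    & before z_axis p c (+) before z_axis p d]
  (+) [&& before x_axis q d (+) before x_axis r d, before z_axis p c (+) before z_axis q c
    & before y_axis q c (+) before y_axis q d]
  (+) [&& before y_axis q c (+) before y_axis r c, before z_axis p c (+) before z_axis q c
    & before x_axis r c (+) before x_axis r d].

(** A path that starts below the surface bounded by the triangle and ends outside its shadow
has to leave through the boundary, under one of the sides, or through the surface.  As a polynomial
identity in the comparison bits this holds in degenerate positions too. *)
Lemma passes_over_triangle p q r c d :
  passes_over p q c d (+) passes_over q r c d (+) passes_over p r c d =
  shadow p q r c (+) shadow p q r d (+) pierce p q r c d.
Proof.
rewrite /passes_over /cross /shadow /pierce; solve_parity.
Qed.

(** The point v lies beyond the x part of the path p-q in the direction of y. *)
Definition shade p q v : bool :=
  (before x_axis p v (+) before x_axis q v) && before y_axis p v.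

(** The left side counts all crossings of the two projected paths.  Such a count is
determined by the positions of the ends of each path relative to the other. *)
Lemma passes_over_sym p q c d :
    p.1 != c.1 -> p.1 != d.1 -> q.1 != c.1 -> q.1 != d.1 ->
  passes_over p q c d (+) passes_over c d p q =
  shade p q c (+) shade p q d (+) (shade c d p (+) shade c d q)
  (+) (before x_axis p c (+) before x_axis p d (+) (before x_axis q c (+) before x_axis q d)).
Proof.
move=> pc pd qc qd; rewrite /passes_over /cross /shade.
rewrite !(before_anti _ pc) !(before_anti _ pd) !(before_anti _ qc) !(before_anti _ qd).
solve_parity.
Qed.

Definition over_chain (B : seq (labelled_point * labelled_point)) p q : bool :=
  \xor_(b <- B) passes_over p q b.1 b.2.

Definition closed_chain (B : seq (labelled_point * labelled_point)) : Prop :=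
  forall w : labelled_point -> bool, \xor_(b <- B) (w b.1 (+) w b.2) = false.

(** Up to ties, some plane orthogonal to the axis k separates the bounding boxes of ps and cs. *)
Definition separated (k : 'I_3) (ps cs : seq labelled_point) : Prop :=
  exists v : bool, {in ps & cs, forall p c, before k p c = v}.

Lemma pierce_separated k p q r c d :
  separated k [:: p; q; r] [:: c; d] -> pierce p q r c d = false.
Proof.
case=> v sep.
have {}sep x y : x \in [:: p; q; r] -> y \in [:: c; d] -> before k x y = v.
  exact: sep.
have kE : [|| k == x_axis, k == y_axis | k == z_axis].
  by case: k {sep} => -[|[|[|]]] // i; rewrite -!val_eqE /= !inordK.
rewrite /pierce; case/or3P: kE sep => /eqP-> sep;
rewrite !sep ?inE ?eqxx ?orbT //; case: v {sep} => //=; rewrite ?andbF //.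
Qed.

(** No box around b meets the box around the triangle, so nothing is pierced, and the shadow
terms cancel along the closed chain B. *)
Lemma over_chain_triangle B p q r :
    closed_chain B ->
    {in B, forall b, exists k, separated k [:: p; q; r] [:: b.1; b.2]} ->
  over_chain B p q (+) over_chain B q r = over_chain B p r.
Proof.
move=> clB sepB.
suff: over_chain B p q (+) over_chain B q r (+) over_chain B p r = false.
  by case: (over_chain B p q); case: (over_chain B q r); case: (over_chain B p r).
rewrite /over_chain -!big_split /= -[RHS](clB (shadow p q r)).
apply: eq_big_seq => b /sepB [k sepb].
by rewrite passes_over_triangle (pierce_separated sepb) addbF.
Qed.

Lemma over_chain_refl B p : over_chain B p p = false.
Proof.
rewrite /over_chain big1 // => b _; rewrite /passes_over /cross.
by rewrite !addbb /= andbF.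
Qed.

Lemma xor_telescope n (h : nat -> bool) :
  \xor_(i < n) (h i (+) h i.+1) = h 0%N (+) h n.
Proof.
elim: n => [|n IHn]; first by rewrite big_ord0 addbb.
by rewrite big_ord_recr /= IHn; solve_parity.
Qed.

Lemma over_chain_grid_step B (P : nat -> nat -> labelled_point) n i :
    closed_chain B ->
    (forall j, (j < n)%N -> {in B, forall b, exists k, separated k
       [:: P i j; P i j.+1; P i.+1 j; P i.+1 j.+1] [:: b.1; b.2]}) ->
  (\xor_(j < n) over_chain B (P i j) (P i j.+1))
    (+) (\xor_(j < n) over_chain B (P i.+1 j) (P i.+1 j.+1)) =
  over_chain B (P i 0%N) (P i.+1 0%N) (+) over_chain B (P i n) (P i.+1 n).
Proof.
move=> clB sepB; rewrite -big_split /=.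
rewrite -(xor_telescope n (fun j => over_chain B (P i j) (P i.+1 j))).
apply: eq_bigr => j _.
have sub p q r : {subset [:: p; q; r] <=
      [:: P i j; P i j.+1; P i.+1 j; P i.+1 j.+1]} ->
    over_chain B p q (+) over_chain B q r = over_chain B p r.
  move=> pqr; apply: over_chain_triangle => // b /(sepB j (ltn_ord j)) [k [v sep]].
  by exists k, v => x y /pqr; apply: sep.
have := sub (P i j) (P i j.+1) (P i.+1 j.+1).
have := sub (P i j) (P i.+1 j) (P i.+1 j.+1).
move=> <-; last by move=> x; rewrite !inE => /or3P[]->; rewrite ?orbT.
set a := over_chain _ _ _; set b := over_chain _ _ _; set c := over_chain _ _ _.
set d := over_chain _ _ _.
have /[swap]/[apply] : {subset [:: P i j; P i j.+1; P i.+1 j.+1] <=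
      [:: P i j; P i j.+1; P i.+1 j; P i.+1 j.+1]}.
  by move=> x; rewrite !inE => /or3P[]->; rewrite ?orbT.
by case: a b c d => [] [] [] [].
Qed.

(** Summed over all triangles of a grid that ends in a constant row, the inner edges cancel and
only the first row and the two sides remain. *)
Lemma over_chain_grid B (P : nat -> nat -> labelled_point) m n :
    closed_chain B ->
    (forall i j, (i < m)%N -> (j < n)%N -> {in B, forall b, exists k, separated k
       [:: P i j; P i j.+1; P i.+1 j; P i.+1 j.+1] [:: b.1; b.2]}) ->
    (forall j, (j <= n)%N -> P m j = P m 0%N) ->
  \xor_(j < n) over_chain B (P 0%N j) (P 0%N j.+1) =
  (\xor_(i < m) over_chain B (P i 0%N) (P i.+1 0%N))
    (+) (\xor_(i < m) over_chain B (P i n) (P i.+1 n)).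
Proof.
move=> clB sepB last_cst.
set row := fun i => \xor_(j < n) over_chain B (P i j) (P i j.+1).
have rowm : row m = false.
  rewrite /row big1 // => j _.
  by rewrite (last_cst j (ltnW (ltn_ord j))) (last_cst _ (ltn_ord j)) over_chain_refl.
transitivity (row 0%N (+) row m); first by rewrite rowm addbF.
rewrite -(xor_telescope m row) -big_split.
apply: eq_bigr => i _; apply: over_chain_grid_step => // j jn.
exact: sepB.
Qed.

Definition path_over (n m : nat) (a b : nat -> labelled_point) : bool :=
  \xor_(i < n) \xor_(j < m) passes_over (a i) (a i.+1) (b j) (b j.+1).

Definition path_shade n (a : nat -> labelled_point) v :=
  \xor_(i < n) shade (a i) (a i.+1) v.

(** The terms of [passes_over_sym] at inner points of either path cancel in pairs. *)
Lemma path_over_sym n m (a b : nat -> labelled_point) :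
    (forall i j, (i <= n)%N -> (j <= m)%N -> (a i).1 != (b j).1) ->
  path_over n m a b (+) path_over m n b a =
  path_shade n a (b 0%N) (+) path_shade n a (b m)
  (+) (path_shade m b (a 0%N) (+) path_shade m b (a n))
  (+) (before x_axis (a 0%N) (b 0%N) (+) before x_axis (a 0%N) (b m)
       (+) (before x_axis (a n) (b 0%N) (+) before x_axis (a n) (b m))).
Proof.
move=> lab; rewrite /path_over [X in _ (+) X]exchange_big -big_split /=.
transitivity (\xor_(i < n)
   (shade (a i) (a i.+1) (b 0%N) (+) shade (a i) (a i.+1) (b m)
    (+) (path_shade m b (a i) (+) path_shade m b (a i.+1))
    (+) ((before x_axis (a i) (b 0%N) (+) before x_axis (a i) (b m))
         (+) (before x_axis (a i.+1) (b 0%N) (+) before x_axis (a i.+1) (b m))))).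
  apply: eq_bigr => i _; rewrite -big_split /=.
  under eq_bigr => j _.
    rewrite passes_over_sym ?lab // ?ltn_ord // 1?ltnW ?ltn_ord //.
    over.
  rewrite big_split /= big_split /=.
  rewrite (xor_telescope m (fun j => shade (a i) (a i.+1) (b j))).
  congr (_ (+) _ (+) _); first by rewrite big_split.
  rewrite big_split /=; congr (_ (+) _).
    exact: (xor_telescope m (fun j => before x_axis (a i) (b j))).
  exact: (xor_telescope m (fun j => before x_axis (a i.+1) (b j))).
rewrite big_split /= big_split /=.
congr (_ (+) _ (+) _).
  by rewrite big_split.
  exact: (xor_telescope n (fun i => path_shade m b (a i))).
exact: (xor_telescope n (fun i => before x_axis (a i) (b 0%N) (+) before x_axis (a i) (b m))).
Qed.

Lemma path_over_chain n m (a b : nat -> labelled_point) :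
  path_over n m a b =
  \xor_(i < n) over_chain [seq (b j, b j.+1) | j <- iota 0 m] (a i) (a i.+1).
Proof.
apply: eq_bigr => i _; rewrite /over_chain big_map.
rewrite -(big_mkord xpredT (fun j => passes_over (a i) (a i.+1) (b j) (b j.+1))).
by rewrite /index_iota subn0.
Qed.

End Crossing.

(** * Uniform estimates on the unit cube *)

Section UnitCube.
Variable R : realType.
Implicit Types (F : R * R -> space3 R) (b : R -> space3 R).

(** Compactness of the cube, in the form used below: the index n stands for the mesh
1/(n+1), and a property that holds near every point for small mesh holds everywhere for small mesh. *)
Lemma unit_cube_uniform (P : nat -> R * R * R -> Prop) :
    (forall t s u : R, 0 <= t <= 1 -> 0 <= s <= 1 -> 0 <= u <= 1 ->
       exists2 e : R, 0 < e &
         forall n (z : R * R * R), n.+1%:R^-1 < e -> ball (t, s, u) e z -> P n z) ->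
  exists N, forall n (t s u : R), (N <= n)%N ->
    0 <= t <= 1 -> 0 <= s <= 1 -> 0 <= u <= 1 -> P n (t, s, u).
Proof.
move=> locP; set I := [set x : R | 0 <= x <= 1].
have cI : compact I.
  have -> : I = `[0, 1]%classic by apply/seteqP; split => x; rewrite /= in_itv.
  exact: segment_compact.
have cK : compact ((I `*` I) `*` I) by do !apply: compact_setX.
have /compact_near_coveringP/(_ nat \oo P) := cK.
case=> [|N _ NP].
  move=> [[t s] u] /= [[It Is] Iu]; have [e e0 eP] := locP t s u It Is Iu.
  exists (ball (t, s, u) e, [set n | n.+1%:R^-1 < e :> R]).
    split; first exact: nbhsx_ballx.
    exact: (near_infty_natSinv_lt (interval_inference.PosNum e0)).
  by move=> [z n] /= [zb ne]; apply: eP.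
by exists N => n t s u Nn It Is Iu; apply: NP.
Qed.

Lemma uniform_gap F b : continuous F -> continuous b ->
    (forall t s u, 0 <= t <= 1 -> 0 <= s <= 1 -> 0 <= u <= 1 -> F (t, s) <> b u) ->
  exists2 delta : R, 0 < delta & forall t s u, 0 <= t <= 1 -> 0 <= s <= 1 ->
    0 <= u <= 1 -> delta <= `|b u - F (t, s)|.
Proof.
move=> Fc bc Fb.
pose P n (z : R * R * R) := n.+1%:R^-1 <= `|b z.2 - F z.1|.
have dc (z : R * R * R) : (fun z => `|b z.2 - F z.1|) @ z --> `|b z.2 - F z.1|.
  apply: cvg_norm; apply: cvgB.
    by apply: (@continuous_comp _ _ _ snd b); [exact: cvg_snd | exact: bc].
  by apply: (@continuous_comp _ _ _ fst F); [exact: cvg_fst | exact: Fc].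
have [t s u t01 s01 u01|N NP] := @unit_cube_uniform P.
  set r := `|b u - F (t, s)|.
  have r0 : 0 < r by rewrite normr_gt0 subr_eq0; apply/eqP => /esym; apply: Fb.
  have : \forall z \near ((t, s), u), r / 2 < `|b z.2 - F z.1|.
    by apply: (cvgr_gt _ (dc ((t, s), u))); rewrite /= -/r; lra.
  move=> /nbhs_ballP[e /= e0 eP].
  exists (Num.min e (r / 2)); first by rewrite lt_min e0 divr_gt0.
  move=> n z; rewrite lt_min => /andP[_ nr] zb; rewrite /P ltW // (lt_trans nr) //.
  by apply: eP; apply: le_ball zb; rewrite ge_min lexx.
exists N.+1%:R^-1; first by rewrite invr_gt0.
by move=> t s u; apply: NP.
Qed.

Definition gridpt (n i : nat) : R := i%:R / n.+1%:R.

Lemma gridpt_itv n i : (i <= n.+1)%N -> 0 <= gridpt n i <= 1.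
Proof.
move=> le_in; rewrite /gridpt divr_ge0 ?ler0n //=.
by rewrite ler_pdivrMr ?ltr0n // mul1r ler_nat.
Qed.

Lemma gridptS n i : `|gridpt n i.+1 - gridpt n i| <= n.+1%:R^-1.
Proof.
rewrite /gridpt -mulrBl -natr1 addrAC subrr add0r mul1r ger0_norm //.
by rewrite invr_ge0 ler0n.
Qed.

Lemma coord_near (T : topologicalType) (F : T -> space3 R) (z : T) k :
  continuous F -> (fun z => F z 0 k) @ z --> F z 0 k.
Proof.
move=> Fc; apply: (@continuous_comp _ _ _ F (fun M : 'rV[R]_3 => M 0 k)).
  exact: Fc.
exact: coord_continuous.
Qed.

(** Disjoint images differ locally in some coordinate, by a definite sign, and this extends to
all cells of a fine grid. *)
Lemma separating_mesh F b : continuous F -> continuous b ->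
    (forall t s u, 0 <= t <= 1 -> 0 <= s <= 1 -> 0 <= u <= 1 -> F (t, s) <> b u) ->
  exists N, forall n, (N <= n)%N -> forall i j m,
    (i <= n)%N -> (j <= n)%N -> (m <= n)%N ->
  exists k : 'I_3, exists v : bool, forall i' j' m',
    (i <= i' <= i.+1)%N -> (j <= j' <= j.+1)%N -> (m <= m' <= m.+1)%N ->
    let x := F (gridpt n i', gridpt n j') 0 k in let y := b (gridpt n m') 0 k in
    if v then x < y else y < x.
Proof.
move=> Fc bc Fb.
pose close n (z z' : R * R * R) :=
  [/\ `|z.1.1 - z'.1.1| <= n.+1%:R^-1, `|z.1.2 - z'.1.2| <= n.+1%:R^-1
    & `|z.2 - z'.2| <= n.+1%:R^-1].
pose P n (z : R * R * R) := exists k : 'I_3, exists v : bool, forall z',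
   close n z z' -> if v then F z'.1 0 k < b z'.2 0 k else b z'.2 0 k < F z'.1 0 k.
have [t s u t01 s01 u01|N NP] := @unit_cube_uniform P.
  have [k Fbk] : exists k, F (t, s) 0 k != b u 0 k.
    apply: contrapT => /forallNP FE; apply: (Fb t s u) => //; apply/rowP => k.
    by apply/eqP; have /negP := FE k; rewrite negbK.
  rewrite neq_lt in Fbk.
  have [v vP] : exists v : bool,
      if v then F (t, s) 0 k < b u 0 k else b u 0 k < F (t, s) 0 k.
    by case/orP: Fbk => ?; [exists true|exists false].
  have : \forall z \near ((t, s), u),
      if v then F z.1 0 k < b z.2 0 k else b z.2 0 k < F z.1 0 k.
    pose dF (z : R * R * R) := b z.2 0 k - F z.1 0 k.
    have dFc : dF @ ((t, s), u) --> dF ((t, s), u).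
      apply: cvgB.
        apply: (@continuous_comp _ _ _ snd (fun u => b u 0 k)); first exact: cvg_snd.
        exact: coord_near.
      apply: (@continuous_comp _ _ _ fst (fun z => F z 0 k)); first exact: cvg_fst.
      exact: coord_near.
    case: v vP => vP.
      have : 0 < dF (t, s, u) by rewrite subr_gt0.
      move=> /(cvgr_gt _ dFc); apply: filterS => z.
      by rewrite subr_gt0.
    have : dF (t, s, u) < 0 by rewrite subr_lt0.
    move=> /(cvgr_lt _ dFc); apply: filterS => z.
    by rewrite subr_lt0.
  move=> /nbhs_ballP[e /= e_gt0 He].
  (* Half the radius is left for the size 1/(n+1) of a cell. *)
  exists (e / 2); first by rewrite divr_gt0.
  move=> n [[t' s'] u'] ne /= [[bt bs] bu].
  exists k, v => -[[t2 s2] u2] /= [/= ct cs cu].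
  have near2 (x y z : R) : ball x (e / 2) y -> `|y - z| <= n.+1%:R^-1 ->
      ball x e z.
    rewrite /ball /= => xy yz; apply: le_lt_trans (ler_distD y _ _) _.
    by rewrite [e]splitr ltrD // (le_lt_trans yz).
  apply: (He (t2, s2, u2)); split; first split => /=.
  - exact: near2 bt ct.
  - exact: near2 bs cs.
  - exact: near2 bu cu.
exists N => n Nn i j m le_in le_jn le_mn.
have [||||k [v vP]] := NP n (gridpt n i) (gridpt n j) (gridpt n m) => //;
  try by apply: gridpt_itv; rewrite leqW.
exists k, v => i' j' m' ii' jj' mm'.
have closeS a a' : (a <= a' <= a.+1)%N -> `|gridpt n a - gridpt n a'| <= n.+1%:R^-1.
  rewrite leq_eqVlt => /andP[/orP[/eqP<- _|aa' a'a]].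
    by rewrite subrr normr0 invr_ge0.
  have -> : a' = a.+1 by apply/eqP; rewrite eqn_leq a'a.
  by rewrite distrC gridptS.
by apply: (vP (gridpt n i', gridpt n j', gridpt n m')); split; apply: closeS.
Qed.

End UnitCube.

(** * Curves separated by a sphere *)

Section SplitSphere.
Variable R : realType.
Implicit Types (x y w : space3 R) (A B : set (space3 R)).

Definition sqnorm x : R := \sum_(i < 3) x ord0 i ^+ 2.

Lemma sqnorm_convex_le (s : R) x y : 0 <= s <= 1 ->
  sqnorm ((1 - s) *: x + s *: y) <= (1 - s) * sqnorm x + s * sqnorm y.
Proof.
move=> /andP[s0 s1]; rewrite /sqnorm !mulr_sumr -big_split /=.
apply: ler_sum => i _; rewrite !mxE -subr_ge0.
set a := x _ _; set b := y _ _.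
have -> : (1 - s) * a ^+ 2 + s * b ^+ 2 - ((1 - s) * a + s * b) ^+ 2
    = s * (1 - s) * (a - b) ^+ 2 by ring.
by apply: mulr_ge0 (sqr_ge0 _); apply: mulr_ge0 => //; rewrite subr_ge0.
Qed.

Definition dot x y : R := \sum_(i < 3) x ord0 i * y ord0 i.

Lemma sqnormD x y : sqnorm (x + y) = sqnorm x + 2 * dot x y + sqnorm y.
Proof.
rewrite /sqnorm /dot mulr_sumr -!big_split /=; apply: eq_bigr => i _.
by rewrite !mxE; ring.
Qed.

Lemma sqnorm_ge0 x : 0 <= sqnorm x.
Proof. by apply: sumr_ge0 => i _; exact: sqr_ge0. Qed.

Lemma sqnormZ (a : R) x : sqnorm (a *: x) = a ^+ 2 * sqnorm x.
Proof.
by rewrite /sqnorm mulr_sumr; apply: eq_bigr => i _; rewrite mxE exprMn.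
Qed.

Lemma dotZr (a : R) x y : dot x (a *: y) = a * dot x y.
Proof. by rewrite /dot mulr_sumr; apply: eq_bigr => i _; rewrite mxE; ring. Qed.

(** Two points outside the ball can be moved away in the same direction w without entering it:
adding a positive multiple of w does not decrease a norm when the inner product with w is nonnegative.
A vector w orthogonal to x does it, up to sign. *)
Lemma common_halfspace x y :
  exists w, [/\ sqnorm w = 1, 0 <= dot x w & 0 <= dot y w].
Proof.
suff [w [w0 xw yw]] : exists w, [/\ sqnorm w != 0, dot x w = 0 & 0 <= dot y w].
  exists ((Num.sqrt (sqnorm w))^-1 *: w); split.
  - rewrite sqnormZ exprVn sqr_sqrtr ?sqnorm_ge0 // mulVf //.
  - by rewrite dotZr xw mulr0.
  - by rewrite dotZr mulr_ge0 ?invr_ge0 ?sqrtr_ge0.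
suff [w [w0 xw]] : exists w, sqnorm w != 0 /\ dot x w = 0.
  have [yw|yw] := leP 0 (dot y w); first by exists w.
  exists (-1 *: w); rewrite sqnormZ !dotZr xw mulr0 sqrrN expr1n mul1r.
  by rewrite mulN1r oppr_ge0 ltW.
pose x0 := x 0 0; pose x1 := x 0 1; pose x2 := x 0 (inord 2).
have dotE w : dot x w = x0 * w 0 0 + x1 * w 0 1 + x2 * w 0 (inord 2).
  rewrite /dot !big_ord_recl big_ord0 addr0 /= addrA.
  congr (_ * _ + _ * _ + _ * _); rewrite ?/x1 ?/x2; congr (_ _ _);
  by apply/val_inj; rewrite /= ?inordK.
have sqE w : sqnorm w = w 0 0 ^+ 2 + w 0 1 ^+ 2 + w 0 (inord 2) ^+ 2.
  rewrite /sqnorm !big_ord_recl big_ord0 addr0 /= addrA.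
  congr (_ ^+ 2 + _ ^+ 2 + _ ^+ 2); congr (_ _ _);
  by apply/val_inj; rewrite /= ?inordK.
have [x12|x12] := eqVneq (x0 ^+ 2 + x1 ^+ 2) 0.
  exists (delta_mx 0 0); rewrite sqE dotE !mxE /= -!val_eqE /= inordK //=.
  move: x12 => /eqP; rewrite paddr_eq0 ?sqr_ge0 // !sqrf_eq0 => /andP[/eqP-> _].
  by split; [rewrite !expr0n /= !addr0 expr1n oner_eq0|ring].
exists (\row_j (if j == 0 then - x1 else if j == 1 then x0 else 0)).
rewrite sqE dotE !mxE /= -!val_eqE /= inordK //=; split; last by ring.
by rewrite sqrrN expr0n addr0 addrC.
Qed.

Variables (h : space3 R -> space3 R).
Hypothesis hc : continuous h.
Hypothesis hi : injective h.

Let S := h @` unit_sphere R.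

Lemma segment_component x y :
    (forall s : R, 0 <= s <= 1 -> sqnorm ((1 - s) *: x + s *: y) != 1) ->
  connected_component (~` S) (h x) (h y).
Proof.
move=> avoid.
pose path := h \o (fun s : R => (1 - s) *: x + s *: y).
have path_c : continuous path.
  move=> s; apply: continuous_comp; last exact: hc.
  apply: cvgD; apply: cvgZr_tmp; last exact: cvg_id.
  by apply: cvgB; [exact: cvg_cst|exact: cvg_id].
have p0 : path 0 = h x by rewrite /path /= subr0 scale1r scale0r addr0.
have p1 : path 1 = h y by rewrite /path /= subrr scale1r scale0r add0r.
have mem0 : (0 : R) \in `[0, 1] by rewrite in_itv /= lexx ler01.
have mem1 : (1 : R) \in `[0, 1] by rewrite in_itv /= lexx ler01.
apply: (@connected_component_max _ (~` S) (path @` `[0, 1]%classic)).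
- by exists 0.
- move=> _ [s + <-]; rewrite /= in_itv /= => s01 [z z1 /hi zE].
  by have /eqP := avoid s s01; apply; rewrite -zE; exact: z1.
- apply: connected_continuous_connected; first exact: segment_connected.
  by apply: continuous_subspaceT.
- by exists 1.
Qed.

Lemma inside_component x y : sqnorm x < 1 -> sqnorm y < 1 ->
  connected_component (~` S) (h x) (h y).
Proof.
move=> x1 y1; apply: segment_component => s s01; rewrite lt_eqF //.
apply: le_lt_trans (sqnorm_convex_le _ _ s01) _.
move: s01 => /andP[s0 s1]; have : (1 - s) * sqnorm x <= (1 - s) * Num.max (sqnorm x) (sqnorm y).
  by rewrite ler_wpM2l ?subr_ge0 // le_max lexx.
have : s * sqnorm y <= s * Num.max (sqnorm x) (sqnorm y).
  by rewrite ler_wpM2l // le_max lexx orbT.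
have : Num.max (sqnorm x) (sqnorm y) < 1 by rewrite gt_max x1.
by move: (_ * sqnorm x) (_ * sqnorm y) (Num.max _ _) => a b m; lra.
Qed.

(** Both points move far away along a common direction, where the segment between them stays
outside the ball. *)
Lemma outside_component x y : 1 < sqnorm x -> 1 < sqnorm y ->
  connected_component (~` S) (h x) (h y).
Proof.
move=> x1 y1; have [w [w1 xw yw]] := common_halfspace x y.
(* A distance at which the translates of x and y have norm more than 1. *)
pose L := 2 + sqnorm x + sqnorm y.
have far z : 1 < sqnorm z -> 0 <= dot z w -> sqnorm z <= L ->
    connected_component (~` S) (h z) (h (z + L *: w)).
  move=> z1 zw zL; apply: segment_component => s /andP[s0 s1].
  rewrite gt_eqF //.
  have -> : (1 - s) *: z + s *: (z + L *: w) = z + (s * L) *: w.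
    by rewrite scalerDr addrA -scalerDl subrK scale1r scalerA.
  rewrite sqnormD dotZr sqnormZ w1 mulr1 -addrA ltr_wpDr //.
  rewrite addr_ge0 ?sqr_ge0 // !mulr_ge0 //.
  by rewrite /L !addr_ge0 ?sqnorm_ge0.
apply: connected_component_trans (far x x1 xw _) _.
  by rewrite /L; have := sqnorm_ge0 y; lra.
apply: connected_component_trans (connected_component_sym (far y y1 yw _)).
  apply: segment_component => s s01; rewrite gt_eqF //.
  have -> : (1 - s) *: (x + L *: w) + s *: (y + L *: w) =
      ((1 - s) *: x + s *: y) + L *: w.
    rewrite !scalerDr addrACA; congr (_ + _).
    by rewrite -scalerDl subrK scale1r.
  set z := (1 - s) *: x + s *: y.
  have zw : 0 <= dot z w.
    have -> : dot z w = (1 - s) * dot x w + s * dot y w.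
      rewrite /z /dot !mulr_sumr -big_split; apply: eq_bigr => i _.
      by rewrite !mxE /=; ring.
    by move: s01 => /andP[s0 s1]; rewrite addr_ge0 // mulr_ge0 // subr_ge0.
  rewrite sqnormD dotZr sqnormZ w1 mulr1.
  have L1 : 2 <= L by rewrite /L; have := sqnorm_ge0 x; have := sqnorm_ge0 y; lra.
  have := sqnorm_ge0 z; have : 0 <= L * dot z w by rewrite mulr_ge0 // (le_trans _ L1).
  move: (L * _) (sqnorm z) => p q; nra.
by rewrite /L; have := sqnorm_ge0 x; lra.
Qed.

End SplitSphere.

(** The interior and the exterior of the sphere are connected, so one of A, B lies inside and the
other outside.  In the coordinates g, the one inside shrinks linearly to the origin. *)
Lemma split_link_shrink (R : realType) (A B : set (space3 R)) a0 b0 :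
    A a0 -> B b0 -> split_link A B ->
  exists g h : space3 R -> space3 R, [/\ continuous g, continuous h, cancel g h &
    (forall (t : R) x y, 0 <= t <= 1 -> A x -> B y -> h ((1 - t) *: g x) <> y) \/
    (forall (t : R) x y, 0 <= t <= 1 -> A x -> B y -> h ((1 - t) *: g y) <> x)].
Proof.
move=> Aa0 Bb0 [_ [[h [g [hc gc hg gh]] ->] ABS comp]].
have hi := can_inj hg.
exists g, h; split => //.
have off x : (A `|` B) x -> sqnorm (g x) != 1.
  move=> /ABS xS; apply/eqP => gx1; apply: xS; exists (g x) => //.
have in_or_out x : (A `|` B) x -> sqnorm (g x) < 1 \/ 1 < sqnorm (g x).
  by move=> /off; rewrite neq_lt => /orP.
have ABx x y : A x -> B y -> ~ (sqnorm (g x) < 1 /\ sqnorm (g y) < 1).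
  move=> Ax By [x1 y1]; apply: (comp x y Ax By).
  by have := inside_component hc hi x1 y1; rewrite !gh.
have ABo x y : A x -> B y -> ~ (1 < sqnorm (g x) /\ 1 < sqnorm (g y)).
  move=> Ax By [x1 y1]; apply: (comp x y Ax By).
  by have := outside_component hc hi x1 y1; rewrite !gh.
have shrink (t : R) x : 0 <= t <= 1 -> sqnorm x < 1 -> sqnorm ((1 - t) *: x) < 1.
  move=> /andP[t0 t1] x1; rewrite sqnormZ; apply: le_lt_trans x1.
  rewrite ler_piMl ?sqnorm_ge0 // -[leRHS](expr1n _ 2).
  by rewrite ler_sqr ?nnegrE; lra.
case: (in_or_out a0) => [|a0in|a0out]; first by left.
  have Bout y : B y -> 1 < sqnorm (g y).
    move=> By; case: (in_or_out y) => //; first by right.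
    by move=> yin; case: (ABx a0 y).
  have Ain x : A x -> sqnorm (g x) < 1.
    move=> Ax; case: (in_or_out x) => //; first by left.
    by move=> xout; case: (ABo x b0) => //; split => //; exact: Bout.
  left=> t x y t01 Ax By hE; have := shrink t _ t01 (Ain _ Ax).
  by rewrite -[(1 - t) *: g x]hg hE; apply/negP; rewrite -leNgt ltW ?Bout.
have Bin y : B y -> sqnorm (g y) < 1.
  move=> By; case: (in_or_out y) => //; first by right.
  by move=> yout; case: (ABo a0 y).
have Aout x : A x -> 1 < sqnorm (g x).
  move=> Ax; case: (in_or_out x) => //; first by left.
  by move=> xin; case: (ABx x b0) => //; split => //; exact: Bin.
right=> t x y t01 Ax By hE; have := shrink t _ t01 (Bin _ By).
by rewrite -[(1 - t) *: g y]hg hE; apply/negP; rewrite -leNgt ltW ?Aout.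
Qed.

(** * The linking parity of sampled curves *)

Lemma eventually_all (T : eqType) (s : seq T) (P : T -> nat -> Prop) :
  (forall x, x \in s -> exists N, forall n, (N <= n)%N -> P x n) ->
  exists N, forall n, (N <= n)%N -> forall x, x \in s -> P x n.
Proof.
elim: s => [|x s IHs] Ps; first by exists 0%N.
have [|N NP] := IHs; first by move=> y ys; apply: Ps; rewrite inE ys orbT.
have [M MP] := Ps x (mem_head _ _).
exists (maxn M N) => n; rewrite geq_max => /andP[Mn Nn] y.
by rewrite inE => /predU1P[->|]; [exact: MP | exact: NP].
Qed.

Section Sampling.
Variable R : realType.
Variable f : 'rV[R]_#|G| -> space3 R.
Hypothesis fc : {within graph_realization R G, continuous f}.

Definition edge_point (e : edge) (s : R) : 'rV[R]_#|G| :=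
  (1 - s) *: vertex_point R (vtx e.1) + s *: vertex_point R (vtx e.2).

(** The nearest point of the unit interval.  It extends an edge curve to the whole line, because f is
continuous on the realization of the graph only. *)
Definition clamp (s : R) : R := (1 + `|s| - `|s - 1|) / 2.

Lemma clamp_itv s : 0 <= clamp s <= 1.
Proof.
rewrite /clamp; have [s0|s0] := leP 0 s; have [s1|s1] := leP 0 (s - 1);
  rewrite ?(ger0_norm s0) ?(ltr0_norm s0) ?(ger0_norm s1) ?(ltr0_norm s1); lra.
Qed.

Lemma clampE s : 0 <= s <= 1 -> clamp s = s.
Proof.
move=> /andP[s0 s1]; rewrite /clamp ger0_norm // ler0_norm ?subr_le0 //; lra.
Qed.

Lemma clamp_continuous : continuous clamp.
Proof.
move=> s; apply: cvgMr_tmp; apply: cvgB; last first.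
  apply: cvg_norm; apply: cvgB; [exact: cvg_id|exact: cvg_cst].
by apply: cvgD; [exact: cvg_cst|apply: cvg_norm; exact: cvg_id].
Qed.

Lemma edge_point_realization e s : e \in edges -> 0 <= s <= 1 ->
  graph_realization R G (edge_point e s).
Proof.
move=> /edgeP[_ i8 j8 adj_e] s01; right; exists (vtx e.1), (vtx e.2).
by split; [rewrite adj_vtx|exists s].
Qed.

Lemma edge_curve_continuous e : e \in edges ->
  continuous (fun s => f (edge_point e (clamp s))).
Proof.
move=> eE s; have /subspace_continuousP fcP := fc.
have q_in u : graph_realization R G (edge_point e (clamp u)).
  exact: edge_point_realization eE (clamp_itv u).
have qc : continuous (fun u => edge_point e (clamp u)).
  move=> u; apply: cvgD; apply: cvgZr_tmp; last exact: clamp_continuous.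
  by apply: cvgB; [exact: cvg_cst|exact: clamp_continuous].
have fq := fcP _ (q_in s).
move=> U fU; have := qc s _ (fq U fU).
by apply: (@filterS _ (nbhs s)) => u; apply.
Qed.

(** At its ends an edge has the labels of its vertices, so that the samples of adjacent edges agree
there; inside, the labels identify the edge, and are larger than those of the vertices.  In any case
disjoint edges have different labels. *)
Definition label n (e : edge) m : nat :=
  if m == 0%N then e.1 else if m == n.+1 then e.2 else (8 + (8 * e.1 + e.2))%N.

Definition sample n (e : edge) (m : nat) : labelled_point R :=
  (label n e m, f (edge_point e (gridpt R n m))).

Definition vertex_sample (v : nat) : labelled_point R := (v, f (vertex_point R (vtx v))).

Lemma gridpt0 n : gridpt R n 0 = 0. Proof. exact: mul0r. Qed.
Lemma gridpt1 n : gridpt R n n.+1 = 1. Proof. by rewrite /gridpt divff ?pnatr_eq0. Qed.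

Lemma sample0 n e : sample n e 0 = vertex_sample e.1.
Proof.
by rewrite /sample gridpt0 /edge_point subr0 scale1r scale0r addr0.
Qed.

Lemma sample1 n e : sample n e n.+1 = vertex_sample e.2.
Proof.
rewrite /sample gridpt1 /edge_point subrr scale1r scale0r add0r.
by rewrite /label eqxx.
Qed.

Lemma label_disjoint n (e e' : edge) m m' : e \in edges -> e' \in edges ->
  ~~ meet e e' -> label n e m != label n e' m'.
Proof.
case: e e' => [i j] [k l] /edgeP /= [_ i8 j8 _] /edgeP /= [_ k8 l8 _].
rewrite /meet !negb_or /= => /and4P[h1 h2 h3 h4]; rewrite /label /=.
by do 4?[case: ifP => _] => //; apply/eqP; lia.
Qed.

Definition edge_over n (e e' : edge) : bool :=
  path_over n.+1 n.+1 (sample n e) (sample n e').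

Definition vertex_shade n (e : edge) (v : nat) : bool :=
  path_shade n.+1 (sample n e) (vertex_sample v).

Definition vbefore (v w : nat) : bool :=
  before x_axis (vertex_sample v) (vertex_sample w).

Lemma edge_over_sym n e e' : e \in edges -> e' \in edges -> ~~ meet e e' ->
  edge_over n e e' (+) edge_over n e' e =
  vertex_shade n e e'.1 (+) vertex_shade n e e'.2
  (+) (vertex_shade n e' e.1 (+) vertex_shade n e' e.2)
  (+) (vbefore e.1 e'.1 (+) vbefore e.1 e'.2
       (+) (vbefore e.2 e'.1 (+) vbefore e.2 e'.2)).
Proof.
move=> eE e'E ee'; rewrite /edge_over path_over_sym ?sample0 ?sample1 //.
by move=> i j _ _; apply: label_disjoint.
Qed.

(** A term that depends on e and on one vertex v, to be added for both ends v of another edge.  It is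
chosen to turn the geometric right-hand side of [edge_over_sym] into [interleave]. *)
Definition correction n (e : edge) (v : nat) : bool :=
  vertex_shade n e v (+) (((v < e.1)%N && vbefore v e.1)
                     (+) ((v < e.2)%N && vbefore v e.2)).

Definition corrected_over n (e e' : edge) : bool :=
  edge_over n e e' (+) (correction n e' e.1 (+) correction n e' e.2).

Lemma vbefore_anti v w : v != w -> vbefore w v = ~~ vbefore v w.
Proof. by move=> vw; rewrite /vbefore (@before_anti R x_axis (vertex_sample v)). Qed.

(** The shades cancel against the corrections, and for each of the four pairs of endpoints
the bits comparing the x coordinates combine to the bit comparing the vertex numbers. *)
Lemma corrected_over_skew n e e' : e \in edges -> e' \in edges -> ~~ meet e e' ->
  corrected_over n e e' (+) corrected_over n e' e = interleave e e'.
Proof.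
move=> eE e'E ee'.
have := edge_over_sym n eE e'E ee'; move: ee'; rewrite /meet !negb_or.
move=> /and4P[h11 h12 h21 h22] E.
have split_before v w : v != w ->
    ((v < w)%N && vbefore v w) (+) ((w < v)%N && vbefore w v) =
    vbefore v w (+) ~~ (v < w)%N.
  move=> vw; rewrite (vbefore_anti vw); move: vw; rewrite neq_ltn.
  by case: ltngtP => //= _ _; case: (vbefore v w).
rewrite /corrected_over /correction /interleave.
move: E (split_before _ _ h11) (split_before _ _ h12) (split_before _ _ h21)
  (split_before _ _ h22) => {split_before h11 h12 h21 h22}.
set a := edge_over _ _ _; set b := edge_over _ _ _.
set s1 := vertex_shade n e e'.1; set s2 := vertex_shade n e e'.2.
set s3 := vertex_shade n e' e.1; set s4 := vertex_shade n e' e.2.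
set p1 := vbefore e.1 e'.1; set p2 := vbefore e.1 e'.2.
set p3 := vbefore e.2 e'.1; set p4 := vbefore e.2 e'.2.
set c1 := (e.1 < e'.1)%N; set c2 := (e.1 < e'.2)%N.
set c3 := (e.2 < e'.1)%N; set c4 := (e.2 < e'.2)%N.
set d1 := _ && vbefore e'.1 e.1; set d2 := _ && vbefore e'.2 e.1.
set d3 := _ && vbefore e'.1 e.2; set d4 := _ && vbefore e'.2 e.2.
move=> E1 E2 E3 E4 E5.
have -> : d1 = (c1 && p1) (+) (p1 (+) ~~ c1) by rewrite -E2 addKb.
have -> : d2 = (c2 && p2) (+) (p2 (+) ~~ c2) by rewrite -E3 addKb.
have -> : d3 = (c3 && p3) (+) (p3 (+) ~~ c3) by rewrite -E4 addKb.
have -> : d4 = (c4 && p4) (+) (p4 (+) ~~ c4) by rewrite -E5 addKb.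
have -> : a = b (+) (s1 (+) s2 (+) (s3 (+) s4) (+) (p1 (+) p2 (+) (p3 (+) p4))).
  by rewrite -E1 [a (+) b]addbC addKb.
solve_parity.
Qed.

Definition chain n (d : seq edge) : seq (labelled_point R * labelled_point R) :=
  flatten [seq [seq (sample n e j, sample n e j.+1) | j <- iota 0 n.+1] | e <- d].

(** Every vertex lies on an even number of edges of the cycle; so a sum of vertex terms over the
ends of its edges cancels. *)
Lemma even_cycle c (w : nat -> bool) : cycle_wf c ->
  \xor_(e <- c) (w e.1 (+) w e.2) = false.
Proof.
move=> /andP[_ /eqP c0].
suff -> : \xor_(e <- c) (w e.1 (+) w e.2) =
    \xor_(v <- foldr (fun e acc => toggle e.1 (toggle e.2 acc)) [::] c) w v.
  by rewrite c0 big_nil.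
elim: {c0} c => [|e c IHc]; first by rewrite !big_nil.
by rewrite big_cons IHc /= !big_xor_toggle addbA.
Qed.

Lemma xor_iota_telescope n (h : nat -> bool) :
  \xor_(j <- iota 0 n) (h j (+) h j.+1) = h 0%N (+) h n.
Proof.
rewrite -(xor_telescope n h) -(big_mkord xpredT (fun j => h j (+) h j.+1)).
by rewrite /index_iota subn0.
Qed.

Lemma chain_closed n d : cycle_wf d -> closed_chain (chain n d).
Proof.
move=> wf_d w; rewrite /chain big_flatten big_map.
rewrite -[RHS](even_cycle (fun v => w (vertex_sample v)) wf_d).
apply: eq_bigr => e _; rewrite big_map.
by rewrite (xor_iota_telescope n.+1 (fun j => w (sample n e j))) sample0 sample1.
Qed.

Definition over_parity n (p : seq edge * seq edge) : bool :=
  \xor_(e <- p.1) \xor_(e' <- p.2) edge_over n e e'.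

Lemma over_parity_chain n c d :
  over_parity n (c, d) =
  \xor_(e <- c) \xor_(i < n.+1)
    over_chain (chain n d) (sample n e i) (sample n e i.+1).
Proof.
apply: eq_bigr => e _ /=.
under eq_bigr do rewrite /edge_over path_over_chain.
rewrite exchange_big; apply: eq_bigr => i _.
by rewrite {2}/over_chain /chain big_flatten big_map.
Qed.

(** The corrections depend on single vertices of c, and cancel by [even_cycle]. *)
Lemma parity_corrected_over n c d : cycle_wf c -> cycle_wf d ->
  parity (corrected_over n) (c, d) = over_parity n (c, d).
Proof.
move=> wf_c wf_d; rewrite /parity /over_parity /corrected_over /=.
under eq_bigr do rewrite big_split /=.
rewrite big_split /= [X in _ (+) X]exchange_big /=.
rewrite [X in _ (+) X]big1 ?addbF // => e' _.
exact: (even_cycle (correction n e') wf_c).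
Qed.

Lemma over_parity_sym n c d : cycle_wf c -> cycle_wf d -> disjointb c d ->
  over_parity n (c, d) = over_parity n (d, c).
Proof.
move=> wf_c wf_d /hasPn cd.
have cE e : e \in c -> e \in edges by move: wf_c => /andP[/allP + _]; apply.
have dE e : e \in d -> e \in edges by move: wf_d => /andP[/allP + _]; apply.
suff : over_parity n (c, d) (+) over_parity n (d, c) = false.
  by case: (over_parity _ _) (over_parity _ _) => [] [].
rewrite /over_parity /= [X in _ (+) X]exchange_big -big_split /=.
rewrite (eq_big_seq (fun e => \xor_(e' <- d)
  ((vertex_shade n e e'.1 (+) vertex_shade n e e'.2)
  (+) (vertex_shade n e' e.1 (+) vertex_shade n e' e.2)
  (+) (vbefore e.1 e'.1 (+) vbefore e.1 e'.2
       (+) (vbefore e.2 e'.1 (+) vbefore e.2 e'.2))))); last first.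
  move=> e ec; rewrite -big_split /=; apply: eq_big_seq => e' e'd.
  apply: edge_over_sym; [exact: cE | exact: dE |].
  by have /hasPn := cd e ec; apply.
have shade_d e : \xor_(e' <- d) (vertex_shade n e e'.1 (+) vertex_shade n e e'.2)
    = false by exact: even_cycle.
have shade_c e' : \xor_(e <- c) (vertex_shade n e' e.1 (+) vertex_shade n e' e.2)
    = false by exact: even_cycle.
have before_d e : \xor_(e' <- d) (vbefore e.1 e'.1 (+) vbefore e.1 e'.2
    (+) (vbefore e.2 e'.1 (+) vbefore e.2 e'.2)) = false.
  by rewrite big_split /= (even_cycle (vbefore e.1)) ?(even_cycle (vbefore e.2)).
under eq_bigr => e _ do rewrite big_split big_split /= shade_d before_d addFb addbF.
by rewrite exchange_big big1 //= => e' _; apply: shade_c.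
Qed.

Variables (g h : space3 R -> space3 R).
Hypotheses (gc : continuous g) (hc : continuous h) (gK : cancel g h).

Definition homotopy (e : edge) : R * R -> space3 R :=
  h \o (fun z => (1 - z.1) *: (g \o (fun s => f (edge_point e (clamp s))) \o snd) z).

Lemma homotopy_continuous e : e \in edges -> continuous (homotopy e).
Proof.
move=> eE z; apply: continuous_comp; last exact: hc.
apply: cvgZ; first by apply: cvgB; [exact: cvg_cst | exact: cvg_fst].
apply: continuous_comp; first exact: cvg_snd.
by apply: continuous_comp; [exact: edge_curve_continuous | exact: gc].
Qed.

(** The labels matter in row 0 only, where they must be those of the samples; below it the grid
ends in a single point, for which the labels have to agree. *)
Definition homotopy_grid n (e : edge) (i j : nat) : labelled_point R :=
  (if i == 0%N then label n e j else 0%N,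
   homotopy e (gridpt R n i, gridpt R n j)).

Lemma homotopy_grid0 n e j : (j <= n.+1)%N -> homotopy_grid n e 0 j = sample n e j.
Proof.
move=> jn; rewrite /homotopy_grid /homotopy /= gridpt0 subr0 scale1r gK.
by rewrite clampE // gridpt_itv.
Qed.

Definition vertex_track n (v i : nat) : labelled_point R :=
  (if i == 0%N then v else 0%N,
   h ((1 - gridpt R n i) *: g (f (vertex_point R (vtx v))))).

Lemma homotopy_grid_source n e i : homotopy_grid n e i 0 = vertex_track n e.1 i.
Proof.
rewrite /homotopy_grid /homotopy /= gridpt0 clampE ?lexx ?ler01 //.
by rewrite /edge_point subr0 scale1r scale0r addr0.
Qed.

Lemma homotopy_grid_target n e i : homotopy_grid n e i n.+1 = vertex_track n e.2 i.
Proof.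
rewrite /homotopy_grid /homotopy /= gridpt1 clampE ?lexx ?ler01 //.
by rewrite /edge_point subrr scale1r scale0r add0r /label eqxx.
Qed.

(** The sides of the grid of an edge are the tracks of its two vertices, and the tracks
cancel along the cycle, so [over_chain_grid] leaves nothing. *)
Lemma contractible_over_parity c d : cycle_wf c -> cycle_wf d ->
    (forall t s u e e', e \in c -> e' \in d -> 0 <= t <= 1 -> 0 <= s <= 1 ->
       0 <= u <= 1 -> h ((1 - t) *: g (f (edge_point e s))) <> f (edge_point e' u)) ->
  exists N, forall n, (N <= n)%N -> over_parity n (c, d) = false.
Proof.
move=> wf_c wf_d avoid.
have cE e : e \in c -> e \in edges by move: wf_c => /andP[/allP + _]; apply.
have dE e : e \in d -> e \in edges by move: wf_d => /andP[/allP + _]; apply.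
have /eventually_all [N NP] : forall e, e \in c -> exists N, forall n, (N <= n)%N ->
    forall e', e' \in d -> forall i j m, (i <= n)%N -> (j <= n)%N -> (m <= n)%N ->
    exists k, separated k [:: homotopy_grid n e i j; homotopy_grid n e i j.+1;
      homotopy_grid n e i.+1 j; homotopy_grid n e i.+1 j.+1]
      [:: sample n e' m; sample n e' m.+1].
  move=> e ec; apply: eventually_all => e' e'd.
  have [|N NP] := separating_mesh (homotopy_continuous (cE e ec))
      (edge_curve_continuous (dE e' e'd)).
    move=> t s u t01 s01 u01; rewrite /homotopy /= !clampE //.
    exact: avoid.
  exists N => n Nn i j m le_in le_jn le_mn.
  have [k [v vP]] := NP n Nn i j m le_in le_jn le_mn.
  exists k, v => p q pP qP.
  have {pP} [i' [j' [l [ii' jj' ->]]]] : exists i' j' l, [/\ (i <= i' <= i.+1)%N,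
      (j <= j' <= j.+1)%N & p = (l, homotopy e (gridpt R n i', gridpt R n j'))].
    have le0 (a : nat) : (a <= a <= a.+1)%N by rewrite leqnn leqnSn.
    have le1 (a : nat) : (a <= a.+1 <= a.+1)%N by rewrite leqnn leqnSn.
    move: pP; rewrite !inE => /or4P[]/eqP->.
    - by exists i, j; eexists; split.
    - by exists i, j.+1; eexists; split.
    - by exists i.+1, j; eexists; split.
    - by exists i.+1, j.+1; eexists; split.
  have {qP} [m' [l' [mm' ->]]] : exists m' l', (m <= m' <= m.+1)%N /\
      q = (l', f (edge_point e' (clamp (gridpt R n m')))).
    move: qP; rewrite !inE => /orP[]/eqP->.
      exists m; eexists; split; first by rewrite leqnn leqnSn.
      by rewrite clampE ?gridpt_itv ?leqW.
    exists m.+1; eexists; split; first by rewrite leqnn leqnSn.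
    by rewrite clampE ?gridpt_itv.
  have := vP i' j' m' ii' jj' mm'; rewrite /before /=.
  by case: {vP} v; case: ltgtP.
exists N => n /NP {}NP; rewrite over_parity_chain.
rewrite -[RHS](even_cycle (fun v => \xor_(i < n.+1)
  over_chain (chain n d) (vertex_track n v i) (vertex_track n v i.+1)) wf_c).
apply: eq_big_seq => e ec.
transitivity (\xor_(j < n.+1) over_chain (chain n d)
    (homotopy_grid n e 0 j) (homotopy_grid n e 0 j.+1)).
  by apply: eq_bigr => j _; rewrite !homotopy_grid0 // ltnW.
rewrite (over_chain_grid (m := n.+1)).
- congr (_ (+) _); apply: eq_bigr => i _;
  by rewrite ?homotopy_grid_source ?homotopy_grid_target.
- exact: chain_closed.
- move=> i j le_in le_jn b /flatten_mapP[e' e'd /mapP[m]].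
  rewrite mem_iota => /= lt_mn -> /=.
  exact: NP.
- move=> j jn; rewrite /homotopy_grid /homotopy /= gridpt1 subrr !scale0r //.
Qed.

End Sampling.

Section LowerBound.
Variable R : realType.
Variable f : 'rV[R]_#|G| -> space3 R.
Hypothesis fc : {within graph_realization R G, continuous f}.

Lemma edge_point_cycle c e (s : R) : e \in c -> 0 <= s <= 1 ->
  (f @` cycle_realization R (realize c)) (f (edge_point e s)).
Proof.
move=> ec s01; exists (edge_point e s) => //; exists (vtx e.1), (vtx e.2).
by split; [apply/realizeP; exists e | exists s].
Qed.

Lemma split_over_parity c d : c \in cycles -> d \in cycles -> disjointb c d ->
    split_link (f @` cycle_realization R (realize c))
               (f @` cycle_realization R (realize d)) ->
  exists N, forall n, (N <= n)%N -> over_parity f n (c, d) = false.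
Proof.
move=> cC dC cd; have wf_c := allP cycles_wf _ cC; have wf_d := allP cycles_wf _ dC.
have [e0 e0c] := cycles_nonempty cC; have [e1 e1d] := cycles_nonempty dC.
have i0 : 0 <= (0 : R) <= 1 by rewrite lexx ler01.
case/(split_link_shrink (edge_point_cycle e0c i0) (edge_point_cycle e1d i0)).
move=> g [h [gc hc gK [avoid|avoid]]].
  apply: (contractible_over_parity fc gc hc gK) => // t s u e e' ec e'd t01 s01 u01.
  by apply: avoid => //; apply: edge_point_cycle.
have [N NP] : exists N, forall n, (N <= n)%N -> over_parity f n (d, c) = false.
  apply: (contractible_over_parity fc gc hc gK) => // t s u e e' ec e'd t01 s01 u01.
  by apply: avoid => //; apply: edge_point_cycle.
by exists N => n Nn; rewrite over_parity_sym // NP.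
Qed.

(** One mesh is fine enough for all of the finitely many split pairs; at this mesh the pairs with odd
parity are not split. *)
Theorem nlinks_ge : (53 <= nlinks f)%N.
Proof.
pose split p := split_link (f @` cycle_realization R (realize p.1))
                           (f @` cycle_realization R (realize p.2)).
have [N NP] : exists N, forall n, (N <= n)%N -> forall p, p \in cycle_pairs ->
    split p -> over_parity f n p = false.
  apply: eventually_all => -[c d] /mem_unordered_pairs /= [cC dC cd].
  have [sp|nsp] := pselect (split (c, d)); last by exists 0%N.
  have [N NP] := split_over_parity cC dC cd sp.
  by exists N => n Nn _; apply: NP.
have skew_N p : p \in cycle_pairs -> skew (corrected_over f N) p.
  move=> /mem_unordered_pairs[cC dC /hasPn cd] e e' ep e'p.
  apply: corrected_over_skew; [exact: (cycles_edges cC) | exact: (cycles_edges dC) |].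
  by have /hasPn := cd e ep; apply.
apply: leq_trans (parity_bound skew_N) _.
rewrite -size_filter -(size_map link_of); set ls := map _ _.
have uls : uniq ls.
  rewrite map_inj_in_uniq ?filter_uniq ?unordered_pairs_uniq ?cycles_uniq //.
  move=> p q; rewrite !mem_filter => /andP[_ pP] /andP[_ qP].
  exact: link_of_inj.
rewrite -(card_uniqP uls); apply/subset_leq_card/fintype.subsetP => L.
move=> /mapP[p]; rewrite mem_filter => /andP[par_p pP] ->.
have [cC dC cd] := mem_unordered_pairs pP.
rewrite inE; apply/asboolP; exists (realize p.1), (realize p.2); split=> //.
- by split; apply: realize_is_cycle.
- by apply/eqP; rewrite disjoint_realize //; apply: cycles_edges.
- move=> sp; move: par_p; have := NP N (leqnn _) p pP sp.
  case: p {pP sp} cC dC cd => c d /= cC dC _.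
  by rewrite parity_corrected_over ?(allP cycles_wf) // => ->.
Qed.

End LowerBound.

(** * Star-shaped spheres *)

Section Radial.
Variable R : realType.
Notation V := (space3 R).
Implicit Types (N E : V -> R) (x y : V).

(** The gauges of compact star-shaped neighbourhoods of the origin, without convexity.  The bounds
make the maps between their level sets continuous at the origin. *)
Definition gauge_like N := exists k M : R, [/\ 0 < k, 0 < M,
  continuous N, forall (s : R) x, 0 <= s -> N (s *: x) = s * N x &
  forall x, k * `|x| <= N x <= M * `|x| ].

(** Preserves every ray from the origin and takes the level sets of E to those of N, translated to p. *)
Definition radial (p : V) N E x : V := p + (E x / N x) *: x.
Definition radial_inv (p : V) N E y : V := (N (y - p) / E (y - p)) *: (y - p).

Lemma gauge_gt0 N x : gauge_like N -> x != 0 -> 0 < N x.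
Proof.
move=> [k [M [k0 M0 _ _ /(_ x) /andP[kN _]]]] x0.
by apply: lt_le_trans kN; rewrite mulr_gt0 // normr_gt0.
Qed.

Lemma gauge0 N : gauge_like N -> N 0 = 0.
Proof. by move=> [k [M [_ _ _ h _]]]; rewrite -(scale0r 0) h // mul0r. Qed.

Lemma radial_continuous N E : gauge_like N -> gauge_like E ->
  continuous (fun x => (E x / N x) *: x).
Proof.
move=> gN gE x; have [->|x0] := eqVneq x 0; last first.
  have [k [M [_ _ Nc _ _]]] := gN; have [k' [M' [_ _ Ec _ _]]] := gE.
  have EN : (fun x => E x / N x) @ x --> E x / N x.
    apply: (@cvgM _ _ (nbhs x) _ E (fun x => (N x)^-1)); first exact: Ec.
    by apply: cvgV; [rewrite gt_eqF // gauge_gt0 | exact: Nc].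
  exact: cvgZ EN cvg_id.
have [k [M [k0 M0 Nc Nh Nb]]] := gN; have [k' [M' [k'0 M'0 Ec Eh Eb]]] := gE.
suff lim0 : (fun x : 'rV[R]_3 => (E x / N x) *: x) @ (0 : 'rV[R]_3) --> (0 : 'rV[R]_3).
  by rewrite /continuous_at scaler0; exact: lim0.
apply: (proj2 (@cvgr0Pnorm_lt _ _ _ (nbhs (0 : 'rV[R]_3)) (nbhs_filter _) _)) => e e0.
(* Away from the origin continuity is clear; at it the quotient E / N is bounded by M' / k. *)
have c0 : 0 < M' / k by rewrite divr_gt0.
have bound y : `|(E y / N y) *: y| <= (M' / k) * `|y|.
  have [->|y0] := eqVneq y 0; first by rewrite scaler0 normr0 mulr0.
  have Ny := gauge_gt0 gN y0; have Ey := gauge_gt0 gE y0.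
  rewrite normrZ ler_wpM2r ?normr_ge0 // gtr0_norm ?divr_gt0 //.
  have y_gt0 : 0 < `|y| by rewrite normr_gt0.
  rewrite ler_pdivrMr // mulrAC ler_pdivlMr //.
  have /andP[kN _] := Nb y; have /andP[_ EM] := Eb y.
  apply: (@le_trans _ _ (M' * `|y| * k)); first by rewrite ler_pM2r.
  by rewrite -mulrA ler_pM2l // mulrC.
have : \forall y \near (0 : 'rV[R]_3), `|y| < e / (M' / k).
  apply/(nbhs_normP (0 : 'rV[R]_3)); exists (e / (M' / k)).
    by rewrite /= divr_gt0.
  by move=> y /=; rewrite sub0r normrN.
apply: filterS => y ye; apply: le_lt_trans (bound y) _.
by rewrite mulrC -ltr_pdivlMr.
Qed.

Lemma radialK p N E : gauge_like N -> gauge_like E ->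
  cancel (radial p N E) (radial_inv p N E).
Proof.
move=> gN gE x; rewrite /radial_inv /radial addrC addKr.
have [->|x0] := eqVneq x 0; first by rewrite !scaler0.
have Nx := gauge_gt0 gN x0; have Ex := gauge_gt0 gE x0.
have [k [M [_ _ _ Nh _]]] := gN; have [k' [M' [_ _ _ Eh _]]] := gE.
have EN : 0 <= E x / N x by rewrite divr_ge0 // ltW.
rewrite Nh // Eh // scalerA -[RHS]scale1r; congr (_ *: _).
by field; rewrite !gt_eqF.
Qed.

Lemma radial_invK p N E : gauge_like N -> gauge_like E ->
  cancel (radial_inv p N E) (radial p N E).
Proof.
move=> gN gE y; have := radialK p gE gN (y - p).
rewrite /radial_inv /radial addrC addKr => ->.
by rewrite addrC subrK.
Qed.

Lemma shift_continuous (p : V) : continuous (fun y : V => y - p).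
Proof.
by move=> y; apply: cvg_trans (cvgB cvg_id (cvg_cst p)); exact: cvg_refl.
Qed.

Lemma radial_homeomorphism p N E : gauge_like N -> gauge_like E ->
  homeomorphism (radial p N E).
Proof.
move=> gN gE; exists (radial_inv p N E); split.
- by move=> x; apply: cvg_trans (cvgD (cvg_cst p) (radial_continuous gN gE (x := x))); exact: cvg_refl.
- move=> y; have := continuous_comp (@shift_continuous p y)
    (@radial_continuous _ _ gE gN (y - p)).
  exact.
- exact: radialK.
- exact: radial_invK.
Qed.

Definition euclid x : R := Num.sqrt (sqnorm x).

Lemma coord_le_norm x i : `|x 0 i| <= `|x|.
Proof.
rewrite [leRHS]/Num.norm /= mx_normrE.
exact: (le_bigmax_cond _ (fun ij : 'I_1 * 'I_3 => `|x ij.1 ij.2|) (j := (0, i))).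
Qed.

Lemma norm_le_coord x (a : R) : 0 <= a -> (forall i, `|x 0 i| <= a) -> `|x| <= a.
Proof.
move=> a0 xa; rewrite [leLHS]/Num.norm /= mx_normrE.
by apply: bigmax_le => // -[i j] _ /=; rewrite ord1.
Qed.

Lemma lipschitz_continuous (M : R) N : 0 < M ->
  (forall x y, `|N x - N y| <= M * `|x - y|) -> continuous N.
Proof.
move=> M0 NM x.
apply: (proj2 (@cvgrPdist_lt _ _ _ (nbhs (x : 'rV[R]_3)) (nbhs_filter _) N _)) => e e0.
apply/(nbhs_normP (x : 'rV[R]_3)); exists (e / M); first by rewrite /= divr_gt0.
move=> y /= xy; apply: le_lt_trans (NM _ _) _.
by rewrite mulrC -ltr_pdivlMr.
Qed.

(** The Cauchy-Schwarz inequality. *)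
Lemma dot_sqr_le x y : dot x y ^+ 2 <= sqnorm x * sqnorm y.
Proof.
have [y0|y0] := eqVneq (sqnorm y) 0.
  rewrite y0 mulr0; suff -> : dot x y = 0 by rewrite expr0n.
  move/eqP: y0; rewrite /sqnorm psumr_eq0 => [|i _]; last exact: sqr_ge0.
  move=> /allP y0; rewrite /dot big1 // => i _.
  have := y0 i (mem_index_enum _); rewrite sqrf_eq0 => /eqP->.
  by rewrite mulr0.
have y_gt0 : 0 < sqnorm y by rewrite lt_def y0 sqnorm_ge0.
have := sqnorm_ge0 (sqnorm y *: x + (- dot x y) *: y).
rewrite sqnormD !sqnormZ dotZr.
have -> : dot (sqnorm y *: x) y = sqnorm y * dot x y.
  by rewrite /dot mulr_sumr; apply: eq_bigr => i _; rewrite mxE mulrA.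
set a := sqnorm x; set b := sqnorm y in y_gt0 *; set d := dot x y => pos.
rewrite -subr_ge0 -(pmulr_rge0 _ y_gt0).
by congr (0 <= _): pos; ring.
Qed.

Lemma euclid_ge0 x : 0 <= euclid x. Proof. exact: sqrtr_ge0. Qed.

Lemma euclid_sqr x : euclid x ^+ 2 = sqnorm x.
Proof. by rewrite sqr_sqrtr ?sqnorm_ge0. Qed.

Lemma euclid_triangle x y : euclid (x + y) <= euclid x + euclid y.
Proof.
have dxy : dot x y <= euclid x * euclid y.
  apply: le_trans (ler_norm _) _.
  rewrite -ler_sqr ?nnegrE ?mulr_ge0 ?euclid_ge0 // exprMn !euclid_sqr real_normK ?num_real //.
  exact: dot_sqr_le.
rewrite -ler_sqr ?nnegrE ?addr_ge0 ?euclid_ge0 // euclid_sqr sqnormD sqrrD !euclid_sqr.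
by move: dxy; rewrite mulr2n; lra.
Qed.

Lemma euclid_le_norm x : euclid x <= 3 * `|x|.
Proof.
rewrite -ler_sqr ?nnegrE ?euclid_ge0 ?mulr_ge0 // euclid_sqr.
apply: (@le_trans _ _ (\sum_(i < 3) `|x| ^+ 2)).
  apply: ler_sum => i _; rewrite -[leLHS]real_normK ?num_real //.
  by rewrite ler_sqr ?nnegrE // coord_le_norm.
rewrite sumr_const card_ord exprMn -[leLHS]mulr_natl ler_wpM2r ?sqr_ge0 //.
by rewrite -natrX ler_nat.
Qed.

Lemma norm_le_euclid x : `|x| <= euclid x.
Proof.
apply: norm_le_coord; first exact: euclid_ge0.
move=> i; rewrite -ler_sqr ?nnegrE ?euclid_ge0 // euclid_sqr real_normK ?num_real //.
by rewrite /sqnorm (bigD1 i) //= lerDl sumr_ge0 // => j _; exact: sqr_ge0.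
Qed.

Lemma gauge_euclid : gauge_like euclid.
Proof.
exists 1, 3; split=> //.
- apply: (@lipschitz_continuous 3) => // x y; rewrite ler_norml.
  have := euclid_triangle (x - y) y; have := euclid_triangle (y - x) x.
  have := euclid_le_norm (x - y); have := euclid_le_norm (y - x).
  rewrite !subrK -[`|y - x|]distrC; lra.
- move=> s x s0; rewrite /euclid sqnormZ sqrtrM ?sqr_ge0 //.
  by rewrite sqrtr_sqr ger0_norm.
- by move=> x; rewrite mul1r norm_le_euclid euclid_le_norm.
Qed.

(** The level set of N at kappa about p is a tame sphere, because N is compared with a multiple of
the Euclidean norm by a radial homeomorphism.  A connected set on which N goes from less to more than
kappa meets it. *)
Lemma gauge_split N p (kappa : R) (A B : set V) : gauge_like N -> 0 < kappa ->
  (forall a, A a -> N (a - p) < kappa) -> (forall b, B b -> kappa < N (b - p)) ->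
  split_link A B.
Proof.
move=> gN k0 Ak Bk.
have [k [M [k_gt0 M_gt0 Nc Nh Nb]]] := gN.
have gE : gauge_like (fun x => kappa * euclid x).
  have [k' [M' [k'0 M'0 Ec Eh Eb]]] := gauge_euclid.
  exists (kappa * k'), (kappa * M'); split; rewrite ?mulr_gt0 //.
  - by move=> x; apply: (@cvgMl_tmp _ _ (nbhs (x : 'rV[R]_3))); exact: Ec.
  - by move=> s x s0; rewrite Eh // mulrCA.
  - by move=> x; rewrite -!mulrA !ler_pM2l.
have NS x : N (radial p N (fun x => kappa * euclid x) x - p) = kappa * euclid x.
  rewrite /radial addrC addKr; have [->|x0] := eqVneq x 0.
    by rewrite scaler0 (gauge0 gN) (gauge0 gE).
  rewrite Nh; last by rewrite divr_ge0 ?mulr_ge0 ?euclid_ge0 // ltW // gauge_gt0.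
  by rewrite divfK // gt_eqF // gauge_gt0.
pose h := radial p N (fun x => kappa * euclid x).
have hS x : (h @` unit_sphere R) x <-> N (x - p) = kappa.
  split=> [[y y1 <-]|xk].
    by rewrite NS /euclid [sqnorm y]y1 sqrtr1 mulr1.
  have hx := radial_invK p gN gE x.
  exists (radial_inv p N (fun x => kappa * euclid x) x) => //.
  rewrite /unit_sphere /= -[LHS]/(sqnorm _) -euclid_sqr.
  suff -> : euclid (radial_inv p N (fun x => kappa * euclid x) x) = 1 by rewrite expr1n.
  by apply: (mulfI (lt0r_neq0 k0)); rewrite mulr1 -NS hx.
exists (h @` unit_sphere R); split.
- by exists h => //; exact: radial_homeomorphism.
- by move=> x [/Ak|/Bk] xk /hS E; move: xk; rewrite E ltxx.
- move=> x y /Ak xk /Bk yk [C [Cx CS Cc] Cy].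
  have : connected ((fun x => N (x - p)) @` C).
    apply: connected_continuous_connected => //.
    apply: continuous_subspaceT => z.
    by have := continuous_comp (@shift_continuous p z) (Nc (z - p)); exact.
  move=> /connected_intervalP/(_ (N (x - p)) (N (y - p))) intv.
  have [||//|z Cz zk] := intv _ _ kappa.
  + by exists x.
  + by exists y.
  + by rewrite !ltW.
  by apply: (CS z Cz); apply/hS.
Qed.

End Radial.

Section Cone.
Variable R : realType.
Notation V := (space3 R).
Variables (p : V) (A : set V) (a0 : V) (D M : R).
Hypotheses (Aa0 : A a0) (D0 : 0 < D) (M0 : 0 < M).
Hypothesis AD : forall a, A a -> `|a - p| <= D.

(** To reach p + y one may run along a ray to the point t(a - p) of the infinite cone over A, at cost t,
and pay M times the distance that remains.  For large M, points of cost at most 1 are close to the cone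
over A from p. *)
Definition cone_costs (y : V) : set R :=
  [set r | exists t : R, exists2 a, A a & 0 <= t /\ r = t + M * `|y - t *: (a - p)|].

Definition cone_gauge (y : V) : R := inf (cone_costs y).

Lemma cone_costs_has_inf y : has_inf (cone_costs y).
Proof.
split; first by exists (0 + M * `|y - 0 *: (a0 - p)|), 0, a0.
exists 0 => _ [t [a Aa [t0 ->]]].
by rewrite addr_ge0 // mulr_ge0 // ltW.
Qed.

Lemma cone_gauge_le y t a : 0 <= t -> A a -> cone_gauge y <= t + M * `|y - t *: (a - p)|.
Proof.
move=> t0 Aa; apply: ge_inf; first by case: (cone_costs_has_inf y).
by exists t, a.
Qed.

Lemma cone_gauge_ge y r : (forall t a, 0 <= t -> A a -> r <= t + M * `|y - t *: (a - p)|) ->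
  r <= cone_gauge y.
Proof.
move=> ry; apply: lb_le_inf; first by case: (cone_costs_has_inf y).
by move=> _ [t [a Aa [t0 ->]]]; apply: ry.
Qed.

Lemma cone_gauge_lipschitz x y : `|cone_gauge x - cone_gauge y| <= M * `|x - y|.
Proof.
suff half u v : cone_gauge u - cone_gauge v <= M * `|u - v|.
  rewrite ler_norml half andbT lerNl opprB.
  by rewrite distrC half.
rewrite lerBlDr -lerBlDl; apply: cone_gauge_ge => t a t0 Aa.
rewrite lerBlDl; apply: le_trans (cone_gauge_le u t0 Aa) _.
rewrite addrCA lerD2l -mulrDr ler_pM2l //.
by apply: le_trans (ler_normD _ _); rewrite addrA subrK.
Qed.

Lemma cone_gauge_homogeneous s y : 0 <= s -> cone_gauge (s *: y) = s * cone_gauge y.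
Proof.
rewrite le_eqVlt => /predU1P[<-|s0].
  rewrite scale0r mul0r; apply/eqP; rewrite eq_le; apply/andP; split.
    by have := cone_gauge_le 0 (lexx 0) Aa0; rewrite scale0r subr0 normr0 mulr0 addr0.
  by apply: cone_gauge_ge => t a t0 Aa; rewrite addr_ge0 // mulr_ge0 // ltW.
have le s' z : 0 < s' -> cone_gauge (s' *: z) <= s' * cone_gauge z.
  move=> s'0; rewrite -ler_pdivrMl //; apply: cone_gauge_ge => t a t0 Aa.
  rewrite ler_pdivrMl //.
  have := cone_gauge_le (s' *: z) (mulr_ge0 (ltW s'0) t0) Aa.
  rewrite -scalerA -scalerBr normrZ gtr0_norm // mulrDr mulrCA.
  by [].
apply/eqP; rewrite eq_le le //= -ler_pdivlMl //.
have := le s^-1 (s *: y); rewrite scalerA mulVf ?gt_eqF // scale1r.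
by apply; rewrite invr_gt0.
Qed.

(** For the lower bound: either the detour from the cone has at least half the length of y, or t
times the radius D of A is at least this half. *)
Lemma cone_gauge_like : gauge_like cone_gauge.
Proof.
(* M / 2 serves the first case, 1 / (2 D) the second. *)
pose k := Num.min (M / 2) (2 * D)^-1.
have k0 : 0 < k.
  by rewrite lt_min divr_gt0 //= invr_gt0 mulr_gt0.
exists k, M; split=> //.
- exact: lipschitz_continuous cone_gauge_lipschitz.
- exact: cone_gauge_homogeneous.
- move=> y; apply/andP; split; last first.
    by have := cone_gauge_le y (lexx 0) Aa0; rewrite scale0r subr0 add0r.
  apply: cone_gauge_ge => t a t0 Aa.
  have [far|near] := leP (`|y| / 2) `|y - t *: (a - p)|.
    apply: (@le_trans _ _ (M * (`|y| / 2))).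
      rewrite mulrCA mulrC [M * _]mulrC mulrC mulrCA mulrC.
      have : k <= M / 2 by rewrite ge_min lexx.
      by move=> kM; have := normr_ge0 y; move: `|y| => n n0; nra.
    apply: (@le_trans _ _ (M * `|y - t *: (a - p)|)); first by rewrite ler_pM2l.
    by rewrite lerDr.
  apply: (@le_trans _ _ t); last by rewrite lerDl mulr_ge0 // ltW.
  have ynorm : `|y| <= `|y - t *: (a - p)| + t * D.
    apply: (@le_trans _ _ (`|y - t *: (a - p)| + `|t *: (a - p)|)).
      by apply: le_trans (ler_normD _ _); rewrite subrK.
    by rewrite lerD2l normrZ ger0_norm // ler_wpM2l ?AD.
  have tD : `|y| / 2 <= t * D by move: near ynorm; lra.
  apply: (@le_trans _ _ ((2 * D)^-1 * `|y|)).
    by rewrite ler_wpM2r // ge_min lexx orbT.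
  by rewrite ler_pdivrMl ?mulr_gt0 //; move: tD; lra.
Qed.

End Cone.

(** The cone gauge is at most 1 on A.  On B it exceeds 1 by a fixed amount when M is large: a smaller
value would place a point of B close to the cone over A. *)
Lemma cone_split (R : realType) (p : space3 R) (A B : set (space3 R)) a0 (D delta : R) :
    A a0 -> 0 < D -> 0 < delta -> (forall a, A a -> `|a - p| <= D) ->
    (forall a b (t : R), A a -> B b -> 0 <= t <= 1 ->
       delta <= `|b - (p + t *: (a - p))|) ->
  split_link A B.
Proof.
move=> Aa0 D0 d0 AD gap.
(* Translate p to the origin.  A point of B within delta / 2 of t(a - p) contradicts the gap if
   t <= 1; if 1 < t < c, then t(a - p) is within (c - 1) D <= delta / 2 of a - p, again a contradiction.  So B has no point
   of cost less than c, as M (delta / 2) = 2 >= c. *)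
pose M := 4 / delta; have M0 : 0 < M by rewrite divr_gt0.
pose c := 1 + Num.min 1 (delta / (2 * D)).
have c1 : 1 < c by rewrite ltrDl lt_min ltr01 divr_gt0 ?mulr_gt0.
have c2 : c <= 2 by rewrite /c; have := ge_min (1 : R) 1 (delta / (2 * D)); lra.
have cD : (c - 1) * D <= delta / 2.
  rewrite /c addrAC subrr add0r; apply: (@le_trans _ _ (delta / (2 * D) * D)).
    by rewrite ler_pM2r // ge_min lexx orbT.
  by rewrite invfM mulrA mulfVK ?gt_eqF.
apply: (gauge_split (p := p) (kappa := (1 + c) / 2) (cone_gauge_like Aa0 D0 M0 AD)).
- lra.
- move=> a Aa; have := cone_gauge_le p Aa0 M0 (a - p) ler01 Aa.
  rewrite scale1r subrr normr0 mulr0 addr0; lra.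
- move=> b Bb; apply: (@lt_le_trans _ _ c); first by lra.
  apply: (cone_gauge_ge Aa0 M0) => t a t0 Aa; rewrite leNgt; apply/negP => lt_c.
  have lt_tc : t < c.
    by apply: le_lt_trans lt_c; rewrite lerDl mulr_ge0 // ltW.
  have dist : `|b - p - t *: (a - p)| < delta / 2.
    have : M * `|b - p - t *: (a - p)| < 2 by move: lt_c; lra.
    rewrite /M mulrAC ltr_pdivrMr // mulrC; lra.
  have [t1|t1] := leP t 1.
    have := gap a b t Aa Bb; rewrite t0 t1 => /(_ isT).
    rewrite opprD addrA; lra.
  have := gap a b 1 Aa Bb; rewrite lexx ler01 => /(_ isT).
  rewrite scale1r opprD addrA.
  have -> : b - p - (a - p) = (b - p - t *: (a - p)) + (t - 1) *: (a - p).
    by rewrite scalerBl scale1r addrA subrK.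
  move=> le_d; have := ler_normD (b - p - t *: (a - p)) ((t - 1) *: (a - p)).
  have : `|(t - 1) *: (a - p)| <= (c - 1) * D.
    rewrite normrZ ger0_norm ?subr_ge0 ?(ltW t1) //.
    by apply: ler_pM; rewrite ?subr_ge0 ?(ltW t1) ?AD ?lerD2r ?(ltW lt_tc).
  lra.
Qed.

(** * Orientations of quadruples of points *)

Definition triple (K : Type) := (K * K * K)%type.

(** The determinant of b - a, c - a, d - a, six times the signed volume of the tetrahedron. *)
Definition orient (K : comNzRingType) (a b c d : triple K) : K :=
  let '(a1, a2, a3) := a in let '(b1, b2, b3) := b in
  let '(c1, c2, c3) := c in let '(d1, d2, d3) := d in
  (b1 - a1) * ((c2 - a2) * (d3 - a3) - (c3 - a3) * (d2 - a2))
  - (b2 - a2) * ((c1 - a1) * (d3 - a3) - (c3 - a3) * (d1 - a1))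
  + (b3 - a3) * ((c1 - a1) * (d2 - a2) - (c2 - a2) * (d1 - a1)).

Section Orient.
Variable K : realFieldType.
Implicit Types (a b c d : triple K).

Definition comb4 (wa wb wc wd : K) a b c d : triple K :=
  (wa * a.1.1 + wb * b.1.1 + wc * c.1.1 + wd * d.1.1,
   wa * a.1.2 + wb * b.1.2 + wc * c.1.2 + wd * d.1.2,
   wa * a.2 + wb * b.2 + wc * c.2 + wd * d.2).

(** Cramer's rule. *)
Lemma affine_independent wa wb wc wd a b c d : orient a b c d != 0 ->
    wa + wb + wc + wd = 0 -> comb4 wa wb wc wd a b c d = (0, 0, 0) ->
  [/\ wa = 0, wb = 0, wc = 0 & wd = 0].
Proof.
case: a b c d => [[a1 a2] a3] [[b1 b2] b3] [[c1 c2] c3] [[d1 d2] d3].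
set D := orient _ _ _ _ => D0 w0 [/= e1 e2 e3].
have wa_E : wa = - (wb + wc + wd) by lra.
pose x1 := wb * (b1 - a1) + wc * (c1 - a1) + wd * (d1 - a1).
pose x2 := wb * (b2 - a2) + wc * (c2 - a2) + wd * (d2 - a2).
pose x3 := wb * (b3 - a3) + wc * (c3 - a3) + wd * (d3 - a3).
have z1 : x1 = 0 by rewrite -e1 /x1 wa_E; ring.
have z2 : x2 = 0 by rewrite -e2 /x2 wa_E; ring.
have z3 : x3 = 0 by rewrite -e3 /x3 wa_E; ring.
(* wb D is the determinant with b - a replaced by (x1, x2, x3) = 0. *)
have wb0 : wb = 0.
  apply: (mulIf D0); rewrite mul0r.
  transitivity (x1 * ((c2 - a2) * (d3 - a3) - (c3 - a3) * (d2 - a2))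
    - x2 * ((c1 - a1) * (d3 - a3) - (c3 - a3) * (d1 - a1))
    + x3 * ((c1 - a1) * (d2 - a2) - (c2 - a2) * (d1 - a1))).
    by rewrite /x1 /x2 /x3 /D /orient; ring.
  by rewrite z1 z2 z3 !mul0r subr0 addr0.
have wc0 : wc = 0.
  apply: (mulIf D0); rewrite mul0r.
  transitivity ((b1 - a1) * (x2 * (d3 - a3) - x3 * (d2 - a2))
    - (b2 - a2) * (x1 * (d3 - a3) - x3 * (d1 - a1))
    + (b3 - a3) * (x1 * (d2 - a2) - x2 * (d1 - a1))).
    by rewrite /x1 /x2 /x3 /D /orient; ring.
  by rewrite z1 z2 z3 !mul0r !subr0 !mulr0 subr0 addr0.
have wd0 : wd = 0.
  apply: (mulIf D0); rewrite mul0r.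
  transitivity ((b1 - a1) * ((c2 - a2) * x3 - (c3 - a3) * x2)
    - (b2 - a2) * ((c1 - a1) * x3 - (c3 - a3) * x1)
    + (b3 - a3) * ((c1 - a1) * x2 - (c2 - a2) * x1)).
    by rewrite /x1 /x2 /x3 /D /orient; ring.
  by rewrite z1 z2 z3 !mulr0 !subr0 !mulr0 subr0 addr0.
by split=> //; rewrite wa_E wb0 wc0 wd0 !addr0 oppr0.
Qed.

(** Two sufficient reasons for the triangle vxy to miss the segment uw: u and w lie strictly on one
side of the plane vxy, or two sides of the triangle have opposite signs as seen from the line uw. *)
Definition misses (L : realDomainType) (v x y u w : triple L) : bool :=
  let t0 := orient u w v x in let t1 := orient u w x y in
  let t2 := orient u w y v in
  [|| 0 < orient v x y u * orient v x y w, t0 * t1 < 0, t1 * t2 < 0 | t0 * t2 < 0].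

Definition bary3 (al be ga : K) v x y : triple K :=
  (al * v.1.1 + be * x.1.1 + ga * y.1.1, al * v.1.2 + be * x.1.2 + ga * y.1.2,
   al * v.2 + be * x.2 + ga * y.2).

Definition bary2 (s : K) u w : triple K :=
  ((1 - s) * u.1.1 + s * w.1.1, (1 - s) * u.1.2 + s * w.1.2, (1 - s) * u.2 + s * w.2).

Lemma opposite_signs (al be ga s t : K) : 0 <= al -> 0 <= ga -> al + be + ga = 1 ->
  al * s = ga * t -> s * t < 0 -> be = 1 /\ s != 0 /\ t != 0.
Proof.
move=> al0 ga0 sum1 E st0.
have s0 : s != 0 by apply: contraTneq st0 => ->; rewrite mul0r ltxx.
have t0 : t != 0 by apply: contraTneq st0 => ->; rewrite mulr0 ltxx.
have s2 : 0 < s ^+ 2 by rewrite exprn_even_gt0.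
have t2 : 0 < t ^+ 2 by rewrite exprn_even_gt0.
have alE : al * s ^+ 2 = ga * (s * t) by rewrite expr2 mulrA E; ring.
have gaE : ga * t ^+ 2 = al * (s * t) by rewrite expr2 mulrA -E; ring.
have al_0 : al = 0.
  apply/eqP; rewrite eq_le al0 andbT -(pmulr_lle0 _ s2) mulrC mulrC alE.
  by rewrite mulr_ge0_le0 // ltW.
have ga_0 : ga = 0.
  apply/eqP; rewrite eq_le ga0 andbT -(pmulr_lle0 _ t2) gaE.
  by rewrite mulr_ge0_le0 // ltW.
by split=> //; move: sum1; rewrite al_0 ga_0 add0r addr0.
Qed.

(** At a common point with barycentric coordinates al, be, ga, the projection along uw gives
al : be : ga = t1 : t2 : t0.  So no two of these determinants have opposite signs. *)
Lemma misses_disjoint v x y u w al be ga s :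
    misses v x y u w -> 0 <= al -> 0 <= be -> 0 <= ga -> al + be + ga = 1 ->
    0 <= s <= 1 ->
  bary3 al be ga v x y <> bary2 s u w.
Proof.
move=> + al0 be0 ga0 sum1 /andP[s0 s1].
have alE : al = 1 - be - ga by rewrite -sum1; ring.
rewrite /misses; set D1 := orient v x y u; set D2 := orient v x y w.
set t0 := orient u w v x; set t1 := orient u w x y; set t2 := orient u w y v.
move=> sgn E.
have affine : orient v x y (bary2 s u w) = (1 - s) * D1 + s * D2.
  rewrite /D1 /D2; case: {+}v {+}x {+}y {+}u {+}w => [[v1 v2] v3] [[x1 x2] x3]
    [[y1 y2] y3] [[u1 u2] u3] [[w1 w2] w3]; rewrite /orient /bary2 /=; ring.
have e0 : (1 - s) * D1 + s * D2 = 0.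
  rewrite -affine -E alE; case: {+}v {+}x {+}y => [[v1 v2] v3] [[x1 x2] x3]
    [[y1 y2] y3]; rewrite /orient /bary3 /=; ring.
have on_line z : orient u w (bary2 s u w) z = 0.
  case: {+}u {+}w {+}z => [[u1 u2] u3] [[w1 w2] w3] [[z1 z2] z3].
  rewrite /orient /bary2 /=; ring.
have bary z : orient u w (bary3 al be ga v x y) z =
    al * orient u w v z + be * orient u w x z + ga * orient u w y z.
  rewrite alE; case: {+}v {+}x {+}y {+}u {+}w {+}z => [[v1 v2] v3] [[x1 x2] x3]
    [[y1 y2] y3] [[u1 u2] u3] [[w1 w2] w3] [[z1 z2] z3].
  rewrite /orient /bary3 /=; ring.
have anti z z' : orient u w z z' = - orient u w z' z.
  case: {+}u {+}w {+}z {+}z' => [[u1 u2] u3] [[w1 w2] w3] [[z1 z2] z3] [[r1 r2] r3].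
  rewrite /orient /=; ring.
have nil z : orient u w z z = 0.
  case: {+}u {+}w {+}z => [[u1 u2] u3] [[w1 w2] w3] [[z1 z2] z3].
  rewrite /orient /=; ring.
have e1 : al * t0 = ga * t1.
  have := bary x; rewrite E on_line nil (anti y x) -/t0 -/t1 => e; lra.
have e2 : al * t2 = be * t1.
  have := bary y; rewrite E on_line nil (anti v y) -/t2 -/t1 => e; lra.
have e3 : be * t0 = ga * t2.
  have := bary v; rewrite E on_line nil (anti x v) -/t0 -/t2 => e; lra.
case/or4P: sgn => sgn.
- have [D1p|D1n] := ltP 0 D1.
    have D2p : 0 < D2 by rewrite -(pmulr_rgt0 _ D1p).
    have : 0 <= (1 - s) * D1 by rewrite mulr_ge0 ?subr_ge0 // ltW.
    have : 0 <= s * D2 by rewrite mulr_ge0 // ltW.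
    move=> h1 h2; have h3 : s * D2 = 0 by lra.
    have h4 : (1 - s) * D1 = 0 by lra.
    move/eqP: h3; rewrite mulf_eq0 (gt_eqF D2p) orbF => /eqP h3.
    by move/eqP: h4; rewrite h3 subr0 mul1r (gt_eqF D1p).
  have {}D1n : D1 < 0.
    rewrite lt_neqAle D1n andbT; apply: contraTneq sgn => ->.
    by rewrite mul0r ltxx.
  have D2n : D2 < 0 by rewrite -(nmulr_rgt0 _ D1n).
  have h1 : (1 - s) * D1 <= 0 by rewrite mulr_ge0_le0 ?subr_ge0 // ltW.
  have h2 : s * D2 <= 0 by rewrite mulr_ge0_le0 // ltW.
  have h3 : s * D2 = 0 by lra.
  have h4 : (1 - s) * D1 = 0 by lra.
  move/eqP: h3; rewrite mulf_eq0 (lt_eqF D2n) orbF => /eqP h3.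
  by move/eqP: h4; rewrite h3 subr0 mul1r (lt_eqF D1n).
- have [be1 [t00 t10]] := opposite_signs al0 ga0 sum1 e1 sgn.
  have [al_0 ga_0] : al = 0 /\ ga = 0 by split; lra.
  by move: e3; rewrite be1 ga_0 mul1r mul0r => /eqP; rewrite (negPf t00).
- have sum1' : be + ga + al = 1 by rewrite -sum1; ring.
  have [ga1 [t10 t20]] := opposite_signs be0 al0 sum1' (esym e2) sgn.
  have [al_0 be_0] : al = 0 /\ be = 0 by split; lra.
  by move: e1; rewrite ga1 al_0 mul1r mul0r => /esym/eqP; rewrite (negPf t10).
- have sum1' : be + al + ga = 1 by rewrite -sum1; ring.
  have [al1 [t00 t20]] := opposite_signs be0 ga0 sum1' e3 sgn.
  have [be_0 ga_0] : be = 0 /\ ga = 0 by split; lra.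
  by move: e1; rewrite al1 ga_0 mul1r mul0r => /eqP; rewrite (negPf t00).
Qed.

End Orient.

(** * A straight-line embedding *)

Local Open Scope Z_scope.

(** Integer coordinates let the signs of all determinants be computed.  What matters of this choice is
expressed by [unlinked_count] and [general_position]. *)
Definition placement : seq (triple Z) :=
  [:: (1, 0, 4); (1, 4, -5); (-5, 0, -5); (2, -2, -4); (-1, 5, 4); (0, 1, -2);
      (-5, -5, 0); (-3, 1, -5)].
Local Close Scope Z_scope.

Definition place (k : nat) : triple Z := nth (0, 0, 0)%R placement k.

(** The cone from v over the cycle c consists of the triangles spanned by v and the edges of c; those
at v are degenerate and lie in c. *)
Definition cone_avoids (v : nat) (c d : seq edge) : bool :=
  all (fun e => (v \in [:: e.1; e.2]) || all (fun e' => misses (place v)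
    (place e.1) (place e.2) (place e'.1) (place e'.2)) d) c.

Definition endpoints (c : seq edge) : seq nat := [seq e.1 | e <- c] ++ [seq e.2 | e <- c].

Definition unlinked (p : seq edge * seq edge) : bool :=
  has (fun v => cone_avoids v p.1 p.2) (endpoints p.1) ||
  has (fun v => cone_avoids v p.2 p.1) (endpoints p.2).

Lemma unlinked_count : (count (predC unlinked) cycle_pairs <= 82)%N.
Proof. by vm_cast_no_check (erefl true). Qed.

Lemma general_position : all (fun a => all (fun b => all (fun c => all (fun d =>
   uniq [:: a; b; c; d] ==> (orient (place a) (place b) (place c) (place d) != 0%R))
   (iota 0 8)) (iota 0 8)) (iota 0 8)) (iota 0 8).
Proof. by vm_cast_no_check (erefl true). Qed.

Lemma split_link_sym (R : realType) (A B : set (space3 R)) :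
  split_link A B -> split_link B A.
Proof.
move=> [S [tS ABS sep]]; exists S; split=> //; first by rewrite setUC.
by move=> x y Bx Ay /connected_component_sym; apply: sep.
Qed.

Section Embedding.
Variable R : realType.

Definition int_cast (z : Z) : R := (int_of_Z z)%:~R.

Definition cast3 (t : triple Z) : triple R := (int_cast t.1.1, int_cast t.1.2, int_cast t.2).

Definition xyz (x : space3 R) : triple R := (x 0 x_axis, x 0 y_axis, x 0 z_axis).

Definition of_xyz (t : triple R) : space3 R :=
  \row_k (if k == x_axis then t.1.1 else if k == y_axis then t.1.2 else t.2).

Lemma of_xyzK : cancel of_xyz xyz.
Proof.
case=> [[a b] c]; rewrite /xyz !mxE /=.
by rewrite -!val_eqE /= !inordK.
Qed.

Definition site (k : nat) : space3 R := of_xyz (cast3 (place k)).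

Definition embed (x : 'rV[R]_#|G|) : space3 R :=
  \sum_(v : G) x 0 (enum_rank v) *: site (code v).

Lemma embed_vertex v : embed (vertex_point R v) = site (code v).
Proof.
rewrite /embed (bigD1 v) //= big1 => [|w wv].
  by rewrite mxE !eqxx scale1r addr0.
by rewrite mxE eqxx /= (inj_eq enum_rank_inj) (negPf wv) scale0r.
Qed.

Lemma embedD x y : embed (x + y) = embed x + embed y.
Proof.
by rewrite /embed -big_split; apply: eq_bigr => v _; rewrite mxE scalerDl.
Qed.

Lemma embedZ (a : R) x : embed (a *: x) = a *: embed x.
Proof.
by rewrite /embed scaler_sumr; apply: eq_bigr => v _; rewrite mxE scalerA.
Qed.

Lemma continuous_sum_scale (T : topologicalType) (I : Type) (r : seq I)
    (g : I -> T -> R) (a : I -> space3 R) : (forall i, continuous (g i)) ->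
  continuous (fun x => \sum_(i <- r) g i x *: a i).
Proof.
move=> gc; elim: r => [|i r IHr] x.
  by under eq_fun do rewrite big_nil; exact: cvg_cst.
under eq_fun do rewrite big_cons.
by apply: cvgD; [apply: cvgZr_tmp; exact: gc | exact: IHr].
Qed.

Lemma embed_continuous : continuous embed.
Proof. by apply: continuous_sum_scale => v x; exact: coord_continuous. Qed.

Lemma embed_edge e (s : R) : e \in edges ->
  embed (edge_point e s) = (1 - s) *: site e.1 + s *: site e.2.
Proof.
move=> /edgeP[_ i8 j8 _].
by rewrite /edge_point embedD !embedZ !embed_vertex !vtxK.
Qed.

Lemma int_castN a : int_cast (- a) = - int_cast a.
Proof. by rewrite /int_cast !rmorphN. Qed.
Lemma int_castD a b : int_cast (a + b) = int_cast a + int_cast b.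
Proof. by rewrite /int_cast !rmorphD. Qed.
Lemma int_castM a b : int_cast (a * b) = int_cast a * int_cast b.
Proof. by rewrite /int_cast !rmorphM. Qed.
Lemma int_cast_gt0 a : (0 < int_cast a) = (0 < a).
Proof. by rewrite /int_cast ltr0z; apply/idP/idP; lia. Qed.
Lemma int_cast_lt0 a : (int_cast a < 0) = (a < 0).
Proof. by rewrite /int_cast ltrz0; apply/idP/idP; lia. Qed.
Lemma int_cast_eq0 a : (int_cast a == 0) = (a == 0).
Proof. by rewrite /int_cast intr_eq0; apply/eqP/eqP; lia. Qed.

Lemma orient_cast a b c d :
  orient (cast3 a) (cast3 b) (cast3 c) (cast3 d) = int_cast (orient a b c d).
Proof.
case: a b c d => [[a1 a2] a3] [[b1 b2] b3] [[c1 c2] c3] [[d1 d2] d3].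
by cbv beta iota zeta delta [orient cast3 fst snd]; rewrite !(int_castD, int_castN, int_castM).
Qed.

Lemma misses_cast v x y u w :
  misses (cast3 v) (cast3 x) (cast3 y) (cast3 u) (cast3 w) = misses v x y u w.
Proof.
by rewrite /misses; cbv zeta; rewrite !orient_cast -!int_castM !int_cast_gt0 !int_cast_lt0.
Qed.

Lemma xyz_site k : xyz (site k) = cast3 (place k).
Proof. exact: of_xyzK. Qed.

Lemma sites_independent a b c d (wa wb wc wd : R) : uniq [:: a; b; c; d] ->
    all (gtn 8) [:: a; b; c; d] -> wa + wb + wc + wd = 0 ->
    wa *: site a + wb *: site b + wc *: site c + wd *: site d = 0 ->
  [/\ wa = 0, wb = 0, wc = 0 & wd = 0].
Proof.
move=> u /and5P[a8 b8 c8 d8 _] w0 s0.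
have mem k : (gtn 8 k)%N -> k \in iota 0 8 by rewrite mem_iota.
have /allP/(_ b (mem _ b8))/allP/(_ c (mem _ c8))/allP/(_ d (mem _ d8)) :=
  allP general_position a (mem _ a8).
rewrite u /= -int_cast_eq0 -orient_cast => or0.
apply: affine_independent or0 w0 _.
rewrite /comb4 -!xyz_site /=.
have coord k : (wa *: site a + wb *: site b + wc *: site c + wd *: site d) 0 k = 0 :> R.
  by rewrite s0 mxE.
by move: (coord x_axis) (coord y_axis) (coord z_axis); rewrite !mxE => -> -> ->.
Qed.

(** The coefficient of the vertex m in the point of parameter s on the edge ij. *)
Definition weight (i j : nat) (s : R) (m : nat) : R :=
  (m == i)%:R * (1 - s) + (m == j)%:R * s.

Lemma weighted_sum (V : lmodType R) (F : nat -> V) q i j s :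
  uniq q -> i \in q -> j \in q ->
  \sum_(m <- q) weight i j s m *: F m = (1 - s) *: F i + s *: F j.
Proof.
move=> uq iq jq.
have pick k (c : R) : k \in q -> \sum_(m <- q) ((m == k)%:R * c) *: F m = c *: F k.
  move=> kq; rewrite (bigD1_seq k) //= eqxx mul1r big1 ?addr0 // => m mk.
  by rewrite (negPf mk) mul0r scale0r.
under eq_bigr do rewrite scalerDl.
by rewrite big_split /= !pick.
Qed.

(** Only the last occurrence of a repeated entry survives, so the last four entries contain
i, j, k and l, and other vertices if these are not distinct. *)
Definition quadruple_of (i j k l : nat) : seq nat :=
  drop 4 (undup (iota 0 8 ++ [:: i; j; k; l])).

Lemma quadruple_of_check : all (fun i => all (fun j => all (fun k => all (fun l =>
    (i != j) && (k != l) ==>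
    [&& size (quadruple_of i j k l) == 4, uniq (quadruple_of i j k l),
      all (gtn 8) (quadruple_of i j k l)
    & all (mem (quadruple_of i j k l)) [:: i; j; k; l]])
    (iota 0 8)) (iota 0 8)) (iota 0 8)) (iota 0 8).
Proof. by vm_cast_no_check (erefl true). Qed.

Lemma four_vertices i j k l : (i < 8)%N -> (j < 8)%N -> (k < 8)%N -> (l < 8)%N ->
  i != j -> k != l -> exists a b c d, [/\ uniq [:: a; b; c; d],
    all (gtn 8) [:: a; b; c; d] & {subset [:: i; j; k; l] <= [:: a; b; c; d]}].
Proof.
have mem m : (m < 8)%N -> m \in iota 0 8 by rewrite mem_iota.
move=> /mem i8 /mem j8 /mem k8 /mem l8 ij kl.
have := allP (allP (allP (allP quadruple_of_check i i8) j j8) k k8) l l8.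
rewrite ij kl; move: (quadruple_of i j k l) => q /and4P[q4 u q8 /allP sub].
case: q q4 u q8 sub => [|a [|b [|c [|d [|? ?]]]]] // _ u q8 sub.
by exists a, b, c, d; split=> // m /sub.
Qed.

(** Two edges have at most four endpoints, which are affinely independent after completion to four
distinct vertices; so a point of space determines its coefficients. *)
Lemma edge_points_eq e e' (s t : R) : e \in edges -> e' \in edges ->
  embed (edge_point e s) = embed (edge_point e' t) ->
  edge_point e s = edge_point e' t /\
  (forall m, weight e.1 e.2 s m = weight e'.1 e'.2 t m).
Proof.
move=> eE e'E; rewrite !embed_edge // => E.
have [lt_e i8 j8 _] := edgeP eE; have [lt_e' k8 l8 _] := edgeP e'E.
have [a [b [c [d [u q8 sub]]]]] :=
  four_vertices i8 j8 k8 l8 (negbT (ltn_eqF lt_e)) (negbT (ltn_eqF lt_e')).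
have [iq jq kq lq] : [/\ e.1 \in [:: a; b; c; d], e.2 \in [:: a; b; c; d],
    e'.1 \in [:: a; b; c; d] & e'.2 \in [:: a; b; c; d]].
  by split; apply: sub; rewrite !inE eqxx ?orbT.
have [w wE] : exists w : nat -> R, forall m,
    w m = weight e.1 e.2 s m - weight e'.1 e'.2 t m by eexists.
have wsum (V : lmodType R) (F : nat -> V) : \sum_(m <- [:: a; b; c; d]) w m *: F m =
    ((1 - s) *: F e.1 + s *: F e.2) - ((1 - t) *: F e'.1 + t *: F e'.2).
  rewrite -(weighted_sum F s u iq jq) -(weighted_sum F t u kq lq) -sumrB.
  by apply: eq_bigr => m _; rewrite wE scalerBl.
have [wa wb wc wd] : [/\ w a = 0, w b = 0, w c = 0 & w d = 0].
  apply: (sites_independent u q8).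
    transitivity (\sum_(m <- [:: a; b; c; d]) w m *: (1 : R^o)).
      rewrite !big_cons big_nil addr0 !addrA.
      by congr (_ + _ + _ + _); rewrite /GRing.scale /= mulr1.
    rewrite (wsum R^o (fun => 1)) /GRing.scale /= !mulr1.
    by rewrite !subrK subrr.
  have := wsum _ site; rewrite !big_cons big_nil addr0 !addrA => ->.
  by rewrite E subrr.
have w0 m : m \in [:: a; b; c; d] -> w m = 0.
  by rewrite !inE => /or4P[]/eqP->.
split; last first.
  move=> m; apply/eqP; rewrite -subr_eq0 -wE; apply/eqP.
  have [/w0//|mq] := boolP (m \in [:: a; b; c; d]).
  have neq k' : k' \in [:: a; b; c; d] -> (m == k') = false.
    by move=> k'q; apply/negbTE; apply: contraNneq mq => ->.
  by rewrite wE /weight !neq // !mul0r !addr0 subrr.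
apply/eqP; rewrite -subr_eq0 /edge_point -(wsum _ (fun k => vertex_point R (vtx k))).
by rewrite big1_seq // => m /andP[_ /w0->]; rewrite scale0r.
Qed.

Lemma disjoint_edge_curves e e' (s t : R) : e \in edges -> e' \in edges ->
  ~~ meet e e' -> embed (edge_point e s) <> embed (edge_point e' t).
Proof.
move=> eE e'E; rewrite /meet !negb_or => /and4P[h1 h2 h3 h4] E.
have [_ W] := edge_points_eq eE e'E E.
have [lt_e _ _ _] := edgeP eE.
have := W e.1; have := W e.2; rewrite /weight !eqxx.
rewrite (negPf h1) (negPf h2) (negPf h3) (negPf h4) (ltn_eqF lt_e) (gtn_eqF lt_e).
by rewrite !mul0r !mul1r !addr0 add0r => -> /eqP; rewrite subr0 oner_eq0.
Qed.

Lemma realization_edge_point x : graph_realization R G x ->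
  exists e, exists2 s : R, e \in edges & 0 <= s <= 1 /\ x = edge_point e s.
Proof.
have seg u v : adj u v -> segment (vertex_point R u) (vertex_point R v) x ->
    exists e, exists2 s : R, e \in edges & 0 <= s <= 1 /\ x = edge_point e s.
  rewrite adj_code => uv [s s01 ->]; have [u8 v8] := (code_lt u, code_lt v).
  have mem m n : (m < n)%N -> (m < 8)%N -> (n < 8)%N -> adjacent m n -> (m, n) \in edges.
    move=> mn m8 n8 amn; rewrite mem_filter; apply/andP; split.
      by apply/andP.
    by apply/allpairsP; exists (m, n); rewrite !mem_iota.
  have uv_neq : code u != code v by case/andP: uv.
  case: (ltngtP (code u) (code v)) uv_neq => // lt_uv _.
    exists (code u, code v), s; first exact: mem.
    by rewrite /edge_point /= !codeK.
  exists (code v, code u), (1 - s).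
    by apply: mem => //; move: uv; rewrite /adjacent eq_sym orbC.
  split; first by move: s01 => /andP[s0 s1]; rewrite subr_ge0 s1 lerBlDr lerDl.
  by rewrite /edge_point /= !codeK subKr addrC.
case=> [[v xv]|[u [v [uv xuv]]]]; last exact: seg xuv.
(* Every vertex has a neighbour, hence lies on an edge. *)
have [w vw] : exists w, adj v w.
  exists (vtx (if (code v < 3)%N then 3 else 0)); rewrite adj_code vtxK; last by case: ifP.
  by rewrite /adjacent; case: ltnP => [|] h; case: (code v) h => [|[|[|n]]].
apply: (seg v w vw); exists 0; first by rewrite lexx ler01.
by rewrite xv subr0 scale1r scale0r addr0.
Qed.

Lemma embed_tame : tame_embedding embed.
Proof.
split.
- exact: continuous_subspaceT embed_continuous.
- move=> x y; rewrite !inE => /realization_edge_point[e [s eE [_ ->]]].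
  move=> /realization_edge_point[e' [t e'E [_ ->]]] E.
  by have [] := edge_points_eq eE e'E E.
- exists id; first by exists id; split=> // x; exact: cvg_id.
  exists [seq (site e.1, site e.2) | e <- edges].
  rewrite image_id; apply/seteqP; split=> x.
    move=> [y /realization_edge_point[e [s eE [s01 ->]]] <-].
    exists (site e.1, site e.2); first by apply: map_f.
    by exists s => //; rewrite embed_edge.
  move=> [_ /mapP[e eE ->] [s s01 ->]]; exists (edge_point e s).
    exact: edge_point_realization.
  by rewrite embed_edge.
Qed.

End Embedding.

Section Upper.
Variable R : realType.

Lemma cycle_realization_point c (x : 'rV[R]_#|G|) : {subset c <= edges} ->
  cycle_realization R (realize c) x ->
  exists e, exists2 s : R, e \in c & 0 <= s <= 1 /\ x = edge_point e s.
Proof.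
move=> cE [u [v [/realizeP[e ec uvE] [s s01 ->]]]].
have [lt_e i8 j8 _] := edgeP (cE e ec).
have neq : vtx e.1 != vtx e.2.
  by apply/eqP => /(vtx_inj i8 j8) E; move: lt_e; rewrite E ltnn.
have /setP/(_ u) := uvE; have /setP/(_ v) := uvE.
have /setP/(_ (vtx e.1)) := uvE; have /setP/(_ (vtx e.2)) := uvE.
rewrite !inE !eqxx ?orbT.
move=> e2 e1 /esym/orP[/eqP vE|/eqP vE] /esym/orP[/eqP uE|/eqP uE];
  rewrite vE uE in e1 e2 *.
- by move: e2; rewrite orbb eq_sym (negPf neq).
- exists e, (1 - s) => //; split.
    by move: s01 => /andP[s0 s1]; rewrite subr_ge0 s1 lerBlDr lerDl.
  by rewrite /edge_point subKr addrC.
- by exists e, s.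
- by move: e1; rewrite orbb (negPf neq).
Qed.

Lemma common_gap (T : eqType) (s : seq T) (P : T -> R -> Prop) :
    (forall x d d', 0 < d' -> d' <= d -> P x d -> P x d') ->
    (forall x, x \in s -> exists2 d : R, 0 < d & P x d) ->
  exists2 d : R, 0 < d & forall x, x \in s -> P x d.
Proof.
move=> mono; elim: s => [|x s IHs] Ps; first by exists 1.
have [|d d0 dP] := IHs; first by move=> y ys; apply: Ps; rewrite inE ys orbT.
have [d' d'0 d'P] := Ps x (mem_head _ _).
have m0 : 0 < Num.min d d' by rewrite lt_min d0.
exists (Num.min d d') => // y; rewrite inE => /predU1P[->|ys].
  by apply: mono d'P => //; rewrite ge_min lexx orbT.
by apply: mono (dP y ys) => //; rewrite ge_min lexx.
Qed.

Lemma site_curve_continuous e : e \in edges ->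
  continuous (fun s : R => embed (edge_point e s)).
Proof.
move=> eE; have -> : (fun s : R => embed (edge_point e s)) =
    (fun s : R => (1 - s) *: site R e.1 + s *: site R e.2).
  by apply/funext => s; rewrite embed_edge.
move=> s; apply: cvgD; apply: cvgZr_tmp; last exact: cvg_id.
by apply: cvgB; [exact: cvg_cst | exact: cvg_id].
Qed.

(** If v is an end of e, then the cone over e is contained in e itself. *)
Lemma cone_edge_disjoint v e e' (t s u : R) : (v < 8)%N -> e \in edges -> e' \in edges ->
    ~~ meet e e' ->
    (v \in [:: e.1; e.2]) || misses (place v) (place e.1) (place e.2)
       (place e'.1) (place e'.2) ->
    0 <= t <= 1 -> 0 <= s <= 1 -> 0 <= u <= 1 ->
  site R v + t *: (embed (edge_point e s) - site R v) <> embed (edge_point e' u).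
Proof.
move=> v8 eE e'E ee' avoid /andP[t0 t1] /andP[s0 s1] u01.
case/orP: avoid => [|miss].
  rewrite !inE => /orP[]/eqP->.
    have -> : site R e.1 + t *: (embed (edge_point e s) - site R e.1) =
        embed (edge_point e (t * s)).
      rewrite !embed_edge //; apply/rowP => k; rewrite !mxE; ring.
    exact: disjoint_edge_curves.
  have -> : site R e.2 + t *: (embed (edge_point e s) - site R e.2) =
      embed (edge_point e (1 - t * (1 - s))).
    rewrite !embed_edge //; apply/rowP => k; rewrite !mxE; ring.
  exact: disjoint_edge_curves.
rewrite !embed_edge // => E.
have := @misses_disjoint R (cast3 R (place v)) (cast3 R (place e.1)) (cast3 R (place e.2))
  (cast3 R (place e'.1)) (cast3 R (place e'.2)) (1 - t) (t * (1 - s)) (t * s) u.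
rewrite misses_cast; apply=> //; rewrite ?mulr_ge0 ?subr_ge0 //; first by ring.
rewrite -!xyz_site /bary3 /bary2 /=.
have coord k : (site R v + t *: ((1 - s) *: site R e.1 + s *: site R e.2 - site R v)) 0 k
    = ((1 - u) *: site R e'.1 + u *: site R e'.2) 0 k by rewrite E.
move: (coord x_axis) (coord y_axis) (coord z_axis); rewrite !mxE => c1 c2 c3.
by congr (_, _, _); rewrite -?c1 -?c2 -?c3; ring.
Qed.

Lemma cone_avoids_split (c d : seq edge) v : {subset c <= edges} -> {subset d <= edges} ->
    c != [::] -> disjointb c d -> (v < 8)%N -> cone_avoids v c d ->
  split_link (embed (R := R) @` cycle_realization R (realize c))
             (embed (R := R) @` cycle_realization R (realize d)).
Proof.
move=> cE dE c0 /hasPn cd v8 /allP avoid.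
(* One number serves as a gap and as the inverse of a radius, so that a single minimum over the
   edges takes care of both. *)
pose gap e (delta : R) := forall s : R, 0 <= s <= 1 ->
  `|embed (edge_point e s) - site R v| <= delta^-1 /\
  forall e', e' \in d -> forall t u : R, 0 <= t <= 1 -> 0 <= u <= 1 -> delta <=
    `|embed (edge_point e' u) - (site R v + t *: (embed (edge_point e s) - site R v))|.
have [delta delta0 deltaP] : exists2 delta : R, 0 < delta & forall e, e \in c ->
    gap e delta.
  apply: common_gap => [e r r' r'0 r'r ger s s01|e ec].
    have [b g] := ger s s01; split.
      by apply: le_trans b _; rewrite lef_pV2 ?posrE // (lt_le_trans r'0).
    by move=> e' e'd t u t01 u01; apply: le_trans r'r _; apply: g.
  have eE := cE e ec.
  have [r r0 rP] : exists2 r : R, 0 < r & forall e', e' \in d -> forall t s u : R,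
      0 <= t <= 1 -> 0 <= s <= 1 -> 0 <= u <= 1 -> r <=
      `|embed (edge_point e' u) - (site R v + t *: (embed (edge_point e s) - site R v))|.
    apply: common_gap => [e' r r' r'0 r'r P t s u t01 s01 u01|e' e'd].
      by apply: le_trans r'r _; apply: P.
    have e'E := dE e' e'd.
    pose F (z : R * R) := site R v + z.1 *: (embed (edge_point e z.2) - site R v).
    have Fc : continuous F.
      move=> z; apply: cvgD; first exact: cvg_cst.
      apply: cvgZ; first exact: cvg_fst.
      apply: cvgB; last exact: cvg_cst.
      apply: (@continuous_comp _ _ _ snd (fun s : R => embed (edge_point e s))).
        exact: cvg_snd.
      exact: site_curve_continuous.
    have [|r r0 rP] := uniform_gap Fc (site_curve_continuous e'E).
      move=> t s u t01 s01 u01; apply: cone_edge_disjoint => //.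
        by have /hasPn := cd e ec; apply.
      by have /orP[->//|/allP/(_ e' e'd) ->] := avoid e ec; rewrite orbT.
    by exists r => // t s u t01 s01 u01; apply: rP.
  pose D := `|site R e.1 - site R v| + `|site R e.2 - site R v| + 1.
  have D0 : 0 < D by rewrite ltr_wpDl // addr_ge0.
  have m0 : 0 < Num.min r D^-1 by rewrite lt_min r0 invr_gt0.
  exists (Num.min r D^-1) => // s s01; split; last first.
    move=> e' e'd t u t01 u01; apply: (@le_trans _ _ r).
      by rewrite ge_min lexx.
    exact: rP.
  apply: (@le_trans _ _ D); last first.
    by rewrite -[leLHS]invrK lef_pV2 ?posrE ?invr_gt0 // ge_min lexx orbT.
  rewrite embed_edge //.
  have -> : (1 - s) *: site R e.1 + s *: site R e.2 - site R v =
      (1 - s) *: (site R e.1 - site R v) + s *: (site R e.2 - site R v).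
    by apply/rowP => k; rewrite !mxE; ring.
  apply: le_trans (ler_normD _ _) _; rewrite /D !normrZ.
  move: s01 => /andP[s0 s1]; rewrite !ger0_norm ?subr_ge0 //.
  apply: ler_wpDr => //; apply: lerD.
    by rewrite ler_piMl // lerBlDr lerDl.
  by rewrite ler_piMl.
case: c c0 cE cd avoid deltaP => // e0 c _ cE cd avoid deltaP.
have i0 : 0 <= (0 : R) <= 1 by rewrite lexx ler01.
apply: (@cone_split R (site R v) _ _ (embed (edge_point e0 0)) delta^-1 delta).
- exact: edge_point_cycle (mem_head _ _) i0.
- by rewrite invr_gt0.
- by [].
- move=> a [x /(cycle_realization_point cE)[e [s ec [s01 ->]]] <-].
  by have [] := deltaP e ec s s01.
- move=> a b t [x /(cycle_realization_point cE)[e [s ec [s01 ->]]] <-].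
  move=> [y /(cycle_realization_point dE)[e' [u e'd [u01 ->]]] <-] t01.
  by have [_] := deltaP e ec s s01; apply.
Qed.

Lemma disjointb_sym (c d : seq edge) : disjointb c d = disjointb d c.
Proof.
rewrite /disjointb; congr (~~ _); apply/hasP/hasP => -[e ec /hasP[e' e'd m]];
  exists e' => //; apply/hasP; exists e => //; move: m; rewrite /meet;
  rewrite !(eq_sym e'.1) !(eq_sym e'.2); by case/or4P=> ->; rewrite ?orbT.
Qed.

Lemma endpoints_lt (c : seq edge) v : {subset c <= edges} -> v \in endpoints c -> (v < 8)%N.
Proof.
move=> cE; rewrite mem_cat => /orP[]/mapP[e /cE /edgeP[_ ? ? _] ->] //.
Qed.

Lemma unlinked_split c d : c \in cycles -> d \in cycles -> disjointb c d ->
    unlinked (c, d) ->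
  split_link (embed (R := R) @` cycle_realization R (realize c))
             (embed (R := R) @` cycle_realization R (realize d)).
Proof.
move=> cC dC cd; have [cE dE] := (cycles_edges cC, cycles_edges dC).
have ne x : x \in cycles -> x != [::].
  by move=> /cycles_nonempty[e]; case: x.
case/orP=> /hasP[v vP av] /=.
  by apply: cone_avoids_split av; rewrite ?ne //; exact: endpoints_lt vP.
apply: split_link_sym; apply: cone_avoids_split av; rewrite ?ne //.
  by rewrite disjointb_sym.
exact: endpoints_lt vP.
Qed.

Lemma nlinks_le_size (H : sgraph) (f : 'rV[R]_#|H| -> space3 R)
    (ls : seq {set {set {set H}}}) :
  (forall L, is_link f L -> L \in ls) -> (nlinks f <= size ls)%N.
Proof.
move=> link_ls; apply: leq_trans (card_size ls).
apply/subset_leq_card/fintype.subsetP => L; rewrite inE => /asboolP.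
exact: link_ls.
Qed.

Theorem nlinks_embed : (nlinks (embed (R := R)) <= 82)%N.
Proof.
apply: leq_trans unlinked_count.
rewrite -size_filter -(size_map link_of); apply: nlinks_le_size => L.
move=> [C1 [C2 [-> [cy1 cy2] dis nsplit]]].
(* Two disjoint cycles with eight vertices in total have at most five each. *)
have card12 : (#|finset.cover C1| + #|finset.cover C2| <= 8)%N.
  by rewrite -cardsUI dis cards0 addn0 -card_G max_card.
have cov1 := card_cover_cycle cy1; have cov2 := card_cover_cycle cy2.
have [|c cC cE] := is_cycle_realize cy1; first by lia.
have [|d dC dE] := is_cycle_realize cy2; first by lia.
subst C1 C2.
have cd : disjointb c d.
  by rewrite -disjoint_realize ?dis //; apply: cycles_edges.
have neq : c != d.
  apply/eqP => E; move: dis cov1; rewrite E finset.setIid => ->; by rewrite cards0.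
have /orP[cdP|dcP] := unordered_pairsP cC dC neq cd (etrans (disjointb_sym d c) cd).
  apply/mapP; exists (c, d); last by [].
  rewrite mem_filter; apply/andP; split; last exact: cdP.
  by apply/negP => /(unlinked_split cC dC cd).
apply/mapP; exists (d, c); last by rewrite /link_of /= finset.setUC.
rewrite mem_filter; apply/andP; split; last exact: dcP.
apply/negP; rewrite disjointb_sym in cd => /(unlinked_split dC cC cd).
by move=> /split_link_sym.
Qed.

End Upper.

(** * The minimal number of links *)

(** A tame embedding exists, so the set of values is nonempty and has a least element; the minimum is
unique, so any choice of it is this one. *)
Lemma mnl_attained (R : realType) (H : sgraph) (f0 : 'rV[R]_#|H| -> space3 R) :
  tame_embedding f0 ->
  exists2 f : 'rV[R]_#|H| -> space3 R, tame_embedding f & mnl R H = nlinks f.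
Proof.
move=> tf0; pose attained n := `[< exists2 f : 'rV[R]_#|H| -> space3 R,
  tame_embedding f & nlinks f = n >].
have ex_n : exists n, attained n by exists (nlinks f0); apply/asboolP; exists f0.
case: (ex_minnP ex_n) => m /asboolP[f tf fm] min_m.
exists f => //; rewrite fm /mnl.
apply: xget_subset1 => [|n n' [[g tg gn] minn] [[g' tg' gn'] minn']].
  by split; [exists f | move=> g tg; apply: min_m; apply/asboolP; exists g].
by apply/eqP; rewrite eqn_leq -{1}gn' minn //= -gn minn'.
Qed.

Lemma mnl_le (R : realType) (H : sgraph) (f : 'rV[R]_#|H| -> space3 R) :
  tame_embedding f -> (mnl R H <= nlinks f)%N.
Proof.
move=> tf; rewrite /mnl; case: xgetP => [n _ [_]|_]; last by [].
exact.
Qed.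

Theorem proposition20 (R : realType) :
  (53 <= mnl R (complete_multipartite [:: 3; 1; 1; 1; 1; 1]%N) <= 82)%N.
Proof.
apply/andP; split.
  have [f [fc _ _] ->] := mnl_attained (embed_tame R).
  exact: nlinks_ge fc.
exact: leq_trans (mnl_le (embed_tame R)) (nlinks_embed R).
Qed.
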